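(* Let $G$ be a simple loopless graph on $[L]$ and let $s_1,\dots,s_L$ be $G$-independent semicircle variables in a $C^*$-probability space $(\mathcal{A},\tau)$ with faithful tracial state $\tau$. Let $A$ be the adjacency operator of the Cayley graph $\operatorname{Cay}(\mathcal{T}(G))$ of the trace monoid $\mathcal{T}(G)$, acting on $\ell^2(\mathcal{T}(G))$. Then \[ \Big\|\sum_{i=1}^{L}s_i\Big\|=\|A\|. \]
   Context: A semicircle variable is a self-adjoint element with standard semicircle distribution (density $\frac{1}{2\pi}\sqrt{4-x^2}$ on $[-2,2]$). Unital subalgebras $\mathcal{A}_1,\dots,\mathcal{A}_L$ are $G$-independent if: (i) for every edge $(i,j)\in E(G)$, $\mathcal{A}_i$ and $\mathcal{A}_j$ are classically independent (commuting, tensor independent); (ii) for every $k\ge1$ and $(i_1,\dots,i_k)\in[L]^k$ such that whenever $i_{j_1}=i_{j_2}$ with $j_1<j_2$ there is $j_3$ with $j_1<j_3<j_2$ and $(i_{j_1},i_{j_3})\notin E(G)$, one has $\tau(a_1\cdots a_k)=0$ for all centered $a_j\in\mathcal{A}_{i_j}$. Variables are $G$-independent if the unital $*$-subalgebras they generate are. The trace monoid of $G$ is the monoid with presentation $\mathcal{T}(G)=\langle v\in V(G) : uv=vu \text{ for all } (u,v)\in E(G)\rangle$ (words in the letters $[L]$ modulo commutation of adjacent letters), with empty word $e$. Two words $w_1,w_2\in\mathcal{T}(G)$ are adjacent if there is a letter $v\in[L]$ with $w_1=vw_2$ or $w_2=vw_1$; $\operatorname{Cay}(\mathcal{T}(G))$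 is the graph on vertex set $\mathcal{T}(G)$ with these adjacencies, and $\|A\|$ is the operator norm of its adjacency operator on $\ell^2(\mathcal{T}(G))$. *)

(* Defs.v *)
From HB Require Import structures.
From mathcomp Require Import all_boot all_order all_algebra.
From mathcomp Require Import all_classical all_reals all_analysis.
From mathcomp Require Import complex.
From Stdlib Require Import Relation_Operators.

Set Implicit Arguments.
Unset Strict Implicit.
Unset Printing Implicit Defensive.
Import Order.TTheory GRing.Theory Num.Theory.
Local Open Scope ring_scope.

Definition simple_loopless_graph (L : nat) (e : rel 'I_L) : Prop :=
  (forall i j : 'I_L, e i j = e j i) /\ (forall i : 'I_L, ~~ e i i).

Definition cmod (R : realType) (c : R[i]) : R := Normc.normc c.

Record Cstar_prob_space (R : realType) (A : algType R[i])
    (star : A -> A) (nrm : A -> R) (tau : A -> R[i]) : Prop := {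
  star_invol : forall x, star (star x) = x;
  star_add : forall x y, star (x + y) = star x + star y;
  star_scale : forall (c : R[i]) x, star (c *: x) = c^* *: star x;
  star_mul : forall x y, star (x * y) = star y * star x;
  nrm_ge0 : forall x, 0 <= nrm x;
  nrm_eq0 : forall x, nrm x = 0 -> x = 0;
  nrm_triangle : forall x y, nrm (x + y) <= nrm x + nrm y;
  nrm_scale : forall (c : R[i]) x, nrm (c *: x) = cmod c * nrm x;
  nrm_submul : forall x y, nrm (x * y) <= nrm x * nrm y;
  nrm_Cstar : forall x, nrm (star x * x) = nrm x ^+ 2;
  nrm_complete : forall u : nat -> A,
    (forall eps : R, 0 < eps -> exists N : nat, forall m n : nat,
        (N <= m)%N -> (N <= n)%N -> nrm (u m - u n) < eps) ->
    exists l : A, forall eps : R, 0 < eps -> exists N : nat, forall n : nat,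
        (N <= n)%N -> nrm (u n - l) < eps;
  tau_add : forall x y, tau (x + y) = tau x + tau y;
  tau_scale : forall (c : R[i]) x, tau (c *: x) = c * tau x;
  tau_unit : tau 1 = 1;
  tau_pos : forall x, 0 <= tau (star x * x);
  tau_trace : forall x y, tau (x * y) = tau (y * x);
  tau_faithful : forall x, tau (star x * x) = 0 -> x = 0
}.

Definition unital_star_subalgebra (R : realType) (A : algType R[i])
    (star : A -> A) (S : set A) : Prop :=
  [/\ S 1,
      forall x y, S x -> S y -> S (x + y),
      forall x y, S x -> S y -> S (x * y),
      forall (c : R[i]) x, S x -> S (c *: x)
    & forall x, S x -> S (star x)].

Definition generated_star_subalgebra (R : realType) (A : algType R[i])
    (star : A -> A) (x : A) : set A :=
  [set a | forall S : set A, unital_star_subalgebra star S -> S x -> S a].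

Definition classically_independent (R : realType) (A : algType R[i])
    (tau : A -> R[i]) (B1 B2 : set A) : Prop :=
  forall a b, B1 a -> B2 b -> a * b = b * a /\ tau (a * b) = tau a * tau b.

Definition G_admissible (L : nat) (e : rel 'I_L) (k : nat) (idx : 'I_k -> 'I_L)
    : Prop :=
  forall j1 j2 : 'I_k, (j1 < j2)%N -> idx j1 = idx j2 ->
    exists j3 : 'I_k, (j1 < j3 < j2)%N /\ ~~ e (idx j1) (idx j3).

Definition G_independent_subalgebras (R : realType) (A : algType R[i])
    (tau : A -> R[i]) (L : nat) (e : rel 'I_L) (B : 'I_L -> set A) : Prop :=
  (forall i j : 'I_L, e i j -> classically_independent tau (B i) (B j)) /\
  (forall (k : nat) (idx : 'I_k -> 'I_L), (1 <= k)%N -> G_admissible e idx ->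
     forall a : 'I_k -> A,
       (forall j, B (idx j) (a j) /\ tau (a j) = 0) ->
       tau (\prod_(j < k) a j) = 0).

Definition G_independent_variables (R : realType) (A : algType R[i])
    (star : A -> A) (tau : A -> R[i]) (L : nat) (e : rel 'I_L)
    (s : 'I_L -> A) : Prop :=
  G_independent_subalgebras tau e
    (fun i => generated_star_subalgebra star (s i)).

Definition semicircle_density (R : realType) (x : R) : R :=
  Num.sqrt (4 - x ^+ 2) / (2 * pi).

Definition semicircle_variable (R : realType) (A : algType R[i])
    (star : A -> A) (tau : A -> R[i]) (s : A) : Prop :=
  star s = s /\
  forall k : nat,
    tau (s ^+ k) =
    ((Rintegral (@lebesgue_measure R) `[(-2)%R, 2%R]
        (fun x : R => x ^+ k * semicircle_density x))%:C)%C.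

Definition trace_step (L : nat) (e : rel 'I_L) (w1 w2 : seq 'I_L) : Prop :=
  exists (a b : seq 'I_L) (u v : 'I_L),
    e u v /\ w1 = a ++ u :: v :: b /\ w2 = a ++ v :: u :: b.

Definition trace_equiv (L : nat) (e : rel 'I_L) : seq 'I_L -> seq 'I_L -> Prop :=
  clos_refl_sym_trans (seq 'I_L) (trace_step e).

Definition trace_class (L : nat) (e : rel 'I_L) (w : seq 'I_L)
    : set (seq 'I_L) :=
  [set w' | trace_equiv e w w'].

Definition trace_monoid_carrier (L : nat) (e : rel 'I_L) : Type :=
  {X : set (seq 'I_L) | exists w, X = trace_class e w}.

Definition trace_monoid (L : nat) (e : rel 'I_L) : choiceType :=
  {classic trace_monoid_carrier e}.

Definition cayley_adj (L : nat) (e : rel 'I_L) (x y : trace_monoid e) : Prop :=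
  exists (v : 'I_L) (w : seq 'I_L),
    (sval x = trace_class e (v :: w) /\ sval y = trace_class e w) \/
    (sval y = trace_class e (v :: w) /\ sval x = trace_class e w).

Local Open Scope ereal_scope.

Definition l2_sqnorm (R : realType) (T : choiceType) (f : T -> R[i])
    : \bar R :=
  \esum_(x in [set: T]) ((cmod (f x)) ^+ 2)%:E.

Definition l2_norm (R : realType) (T : choiceType) (f : T -> R[i]) : \bar R :=
  sqrte (l2_sqnorm f).

Definition in_l2 (R : realType) (T : choiceType) (f : T -> R[i]) : Prop :=
  l2_sqnorm f < +oo.

Local Close Scope ereal_scope.

(* (A f)(x) = sum of f over the neighbours of x (finitely many) *)
Definition adjacency_op (R : realType) (L : nat) (e : rel 'I_L)
    (f : trace_monoid e -> R[i]) : trace_monoid e -> R[i] :=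
  fun x => \sum_(y \in [set y | cayley_adj x y]) f y.

Definition adjacency_opnorm (R : realType) (L : nat) (e : rel 'I_L) : \bar R :=
  ereal_sup [set l2_norm (adjacency_op f) |
             f in [set f : trace_monoid e -> R[i] |
                    in_l2 f /\ (l2_norm f <= 1)%E]].

(* Main.v *)
(**
  For a word [w] in the trace monoid, the elements [xi w] defined by
  [s v * xi w = xi (v w) + xi (v^-1 w)], the last term occurring only if [v]
  left-divides [w], are products of Chebyshev polynomials in the [s v] over the
  blocks of a normal form of [w].  These polynomials are centered for the
  semicircle law, so [G]-independence makes [xi] an orthonormal family, on which
  left multiplication by [S = s_1 + ... + s_L] acts as the Cayley adjacency
  operator.  Thus [M = ||A||] is at most [||S||], and conversely
  [tau ((S y)^* (S y)) <= M^2 tau (y^* y)] for all [y] polynomial in [S].  As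
  [tau] is faithful, this makes [M^2 - S^2] a square [z^2] of a self-adjoint [z]
  commuting with [S], so that [S + i z] has norm [M] and [||S|| <= M].
*)

(* No functional calculus is used. Norm and trace are linked only through square roots of [1 - h],
   for self-adjoint [h] with [nrm h <= 1], built as norm limits of polynomials in [h]. Such a root
   lies in every closed subalgebra containing [h], and this single fact yields both its commutation
   relations and its approximability by polynomials in [S]. The latter matters because the bound by
   [||A||] is available only on finite combinations of the [xi w]; these include the polynomials in
   [S], since [1] is [xi] of the empty word, but the square roots are reached only by passing to the
   limit. The operator norm of [A] is an extended real; its finiteness comes from the inequality
   [||A|| <= ||S||], which the converse then uses. *)
Require Import Defs.
From HB Require Import structures.
From mathcomp Require Import all_boot all_order all_algebra.
From mathcomp Require Import all_classical all_reals all_analysis.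
From mathcomp Require Import complex ring lra.
From Stdlib Require Import Relation_Operators.
Import Order.TTheory GRing.Theory Num.Theory.
Import numFieldNormedType.Exports.

Set Implicit Arguments.
Unset Strict Implicit.
Unset Printing Implicit Defensive.

Local Open Scope classical_set_scope.
Local Open Scope ring_scope.

(** * Words modulo commutation: left division, cancellation and block normal forms *)

Section TraceWords.
Context (L : nat) (e : rel 'I_L).
Hypotheses (e_sym : symmetric e) (e_irr : irreflexive e).

Notation word := (seq 'I_L).
Notation "w ~~~ x" := (trace_equiv e w x) (at level 70).

(* [ldiv v w] holds when [v] left-divides the trace of [w]; [lrem v w] is then a
   word for the quotient. *)
Fixpoint ldiv (v : 'I_L) (w : word) : bool :=
  if w is u :: w' then (u == v) || (e u v && ldiv v w') else false.

Fixpoint lrem (v : 'I_L) (w : word) : word :=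
  if w is u :: w' then if u == v then w' else u :: lrem v w' else [::].

Lemma trace_equiv_cons (v : 'I_L) (w x : word) : w ~~~ x -> v :: w ~~~ v :: x.
Proof.
elim=> {w x} [w x [a [b [u [c [euc [-> ->]]]]]]|w|w x _ IH|w x y _ IH1 _ IH2].
- by apply: rst_step; exists (v :: a), b, u, c.
- exact: rst_refl.
- exact: rst_sym.
- exact: rst_trans IH1 IH2.
Qed.

Lemma trace_equiv_cat (a w x : word) : w ~~~ x -> a ++ w ~~~ a ++ x.
Proof. by elim: a => //= v a IH /IH; apply: trace_equiv_cons. Qed.

Lemma trace_equiv_swap (u v : 'I_L) (w : word) :
  e u v -> u :: v :: w ~~~ v :: u :: w.
Proof. by move=> euv; apply: rst_step; exists [::], w, u, v. Qed.

Lemma trace_equiv_perm (w x : word) : w ~~~ x -> perm_eq w x.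
Proof.
elim=> {w x} [w x [a [b [u [c [_ [-> ->]]]]]]|w|w x _|w x y _ + _].
- rewrite perm_cat2l -[u :: c :: b]/([:: u] ++ [:: c] ++ b).
  by rewrite perm_catCA.
- exact: perm_refl.
- by rewrite perm_sym.
- exact: perm_trans.
Qed.

Lemma lrem_size (v : 'I_L) (w : word) :
  ldiv v w -> (size (lrem v w)).+1 = size w.
Proof.
by elim: w => //= u w IH; case: eqVneq => //= _ /andP[_ /IH <-].
Qed.

Lemma ldiv_equiv (v : 'I_L) (w : word) : ldiv v w -> w ~~~ v :: lrem v w.
Proof.
elim: w => //= u w IH; case: eqVneq => [-> _|_ /andP[euv /IH H]].
  exact: rst_refl.
exact: rst_trans (trace_equiv_cons u H) (trace_equiv_swap _ euv).
Qed.

Lemma ldiv_step (v : 'I_L) (w x : word) :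
  trace_step e w x -> ldiv v w = ldiv v x.
Proof.
move=> [a [b [u [c [euc [-> ->]]]]]]; elim: a => [|d a /= -> //] /=.
case: (eqVneq u v) => [<-|uv]; case: (eqVneq c v) => [cv|cv] //=;
  rewrite ?eqxx ?andbT ?orbT //.
- by rewrite e_sym euc orbT.
- by rewrite e_sym euc orbT.
- by rewrite -cv.
- by rewrite andbCA.
Qed.

(** Deleting the first [v] either removes a letter of the swapped pair, and the results coincide, or
    leaves the pair intact, and one swap still relates them. *)
Lemma lrem_step (v : 'I_L) (w x : word) : trace_step e w x ->
  lrem v w = lrem v x \/ trace_step e (lrem v w) (lrem v x).
Proof.
move=> [a [b [u [c [euc [-> ->]]]]]]; elim: a => [|d a IH] /=.
  case: (eqVneq u v) => [uv|uv]; case: (eqVneq c v) => [cv|cv] /=;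
    rewrite ?uv ?cv ?eqxx; try by left.
  by right; exists [::], (lrem v b), u, c.
case: eqVneq => [_|_]; first by right; exists a, b, u, c.
case: IH => [->|[a' [b' [u' [c' [eu [-> ->]]]]]]]; first by left.
by right; exists (d :: a'), b', u', c'.
Qed.

Lemma ldiv_trace (v : 'I_L) (w x : word) : w ~~~ x -> ldiv v w = ldiv v x.
Proof.
elim=> {w x} [w x /ldiv_step|w|w x _ ->|w x y _ -> _] //.
Qed.

Lemma lrem_trace (v : 'I_L) (w x : word) : w ~~~ x -> lrem v w ~~~ lrem v x.
Proof.
elim=> {w x} [w x /(@lrem_step v)[->|?]|w|w x _ ?|w x y _ H1 _ H2].
- exact: rst_refl.
- exact: rst_step.
- exact: rst_refl.
- exact: rst_sym.
- exact: rst_trans H1 H2.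
Qed.

(** Division and quotient are invariant under commutations, so both can be read off on [v :: w],
    where they give [true] and [w]. This contains left cancellation in the trace monoid. *)
Lemma trace_equiv_consP (v : 'I_L) (w x : word) :
  v :: w ~~~ x <-> ldiv v x /\ w ~~~ lrem v x.
Proof.
split=> [H|[dvx H]].
  rewrite -(ldiv_trace v H) /= eqxx; split=> //.
  by have := lrem_trace v H; rewrite /= eqxx.
exact: rst_trans (trace_equiv_cons v H) (rst_sym _ _ _ _ (ldiv_equiv dvx)).
Qed.

Lemma lremC (u v : 'I_L) (w : word) :
  lrem u (lrem v w) = lrem v (lrem u w).
Proof.
case: (eqVneq u v) => [-> //|uv]; elim: w => //= c w IH.
case: (eqVneq c v) => [cv|cv]; case: (eqVneq c u) => [cu|cu] /=.
- by move: uv; rewrite -cu cv eqxx.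
- by rewrite cv eqxx.
- by rewrite cu eqxx.
- by rewrite (negPf cu) (negPf cv) IH.
Qed.

(** A letter [u] commuting with [v] and distinct from it neither blocks [v] nor supplies it, so
    removing it changes nothing for [v]. *)
Lemma ldiv_lrem (u v : 'I_L) (w : word) :
  e u v -> ldiv u w -> ldiv v (lrem u w) = ldiv v w.
Proof.
move=> euv; have uv : u != v by apply: contraTneq euv => ->; rewrite e_irr.
elim: w => //= c w IH; case: (eqVneq c u) => [-> _|cu /= /andP[_ /IH ->] //].
by rewrite (negPf uv) euv.
Qed.

(** A recursive boolean test that implies [G_admissible]: no letter can be commuted leftwards until
    it meets an earlier equal one. *)
Fixpoint adm (w : word) : bool :=
  if w is v :: w' then ~~ ldiv v w' && adm w' else true.

Lemma ldivN_sep (v x0 : 'I_L) (w : word) (j : nat) : ~~ ldiv v w ->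
  (j < size w)%N -> nth x0 w j = v ->
  exists2 i, (i < j)%N & ~~ e v (nth x0 w i).
Proof.
elim: w j => //= c w IH [|j]; rewrite negb_or => /andP[cv]; first by move/eqP: cv.
rewrite negb_and => /orP[ncv _ _|nd jw jv]; first by exists 0%N; rewrite //= e_sym.
by have [i ij ei] := IH j nd jw jv; exists i.+1.
Qed.

Lemma adm_G_admissible (x0 : 'I_L) (w : word) : adm w ->
  G_admissible e (fun j : 'I_(size w) => nth x0 w j).
Proof.
suff H : adm w -> forall i j : nat, (i < j)%N -> (j < size w)%N ->
    nth x0 w i = nth x0 w j ->
    exists2 k, (i < k < j)%N & ~~ e (nth x0 w i) (nth x0 w k).
  move=> /H{}H j1 j2 lt12 eq12; have [k k12 ek] := H _ _ lt12 (ltn_ord j2) eq12.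
  have kw : (k < size w)%N.
    by case/andP: k12 => _ /ltn_trans; apply; apply: ltn_ord.
  by exists (Ordinal kw).
elim: w => //= v w IH /andP[nd aw] [|i] [|j] //= ij jw eqij.
- by have [k kj ek] := ldivN_sep nd jw (esym eqij); exists k.+1.
- by have [k kj ek] := IH aw i j ij jw eqij; exists k.+1.
Qed.

(** The pair [(v, k)] stands for [k + 1] copies of [v], so blocks are nonempty by construction; only
    Chebyshev polynomials of positive degree are centered. *)
Definition block_word (bs : seq ('I_L * nat)) : word :=
  flatten [seq nseq b.2.+1 b.1 | b <- bs].

Lemma ldiv_block_word (v : 'I_L) (bs : seq ('I_L * nat)) :
  ldiv v (block_word bs) = ldiv v [seq b.1 | b <- bs].
Proof.
elim: bs => //= -[u k] bs IH /=; rewrite -IH.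
elim: k => //= k ->; case: eqVneq => //= _; by rewrite andbA andbb.
Qed.

Lemma extract_power (v : 'I_L) (w : word) :
  exists k x, [/\ w ~~~ nseq k v ++ x, ~~ ldiv v x & size w = (k + size x)%N].
Proof.
have [n] := ubnP (size w); elim: n w => // n IH w; rewrite ltnS => szw.
case: (boolP (ldiv v w)) => [dv|nd]; last first.
  by exists 0%N, w; split=> //=; apply: rst_refl.
have szr := lrem_size dv.
have [|k [x [eq_r ndx szx]]] := IH (lrem v w); first by rewrite szr.
exists k.+1, x; split=> //=; last by rewrite addSn -szx szr.
exact: rst_trans (ldiv_equiv dv) (trace_equiv_cons v eq_r).
Qed.

Lemma block_word_exists (w : word) :
  exists2 bs, w ~~~ block_word bs & adm [seq b.1 | b <- bs].
Proof.
have [n] := ubnP (size w); elim: n w => // n IH [|v w] /=; rewrite ltnS => szw.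
  by exists [::] => //; apply: rst_refl.
have [k [x [eq_x ndx szx]]] := extract_power v w.
have [|bs eq_bs abs] := IH x.
  by apply: leq_ltn_trans szw; rewrite szx leq_addl.
(* The leading [v] and the [k] copies extracted from [w] form a block of [k + 1] letters; [x] is not
   divisible by [v], which keeps the letters admissible. *)
exists ((v, k) :: bs).
  apply: trace_equiv_cons; apply: rst_trans eq_x _.
  by rewrite -/(block_word bs); apply: trace_equiv_cat.
by rewrite /= abs andbT -ldiv_block_word -(ldiv_trace v eq_bs).
Qed.

End TraceWords.

(** * Square roots of [1 - h] by iteration in a C*-algebra *)

Section CstarSqrt.
Context (R : realType) (A : algType R[i]).
Variables (star : A -> A) (nrm : A -> R) (tau : A -> R[i]).
Hypothesis CA : Cstar_prob_space star nrm tau.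

Local Notation "r %:C" := (real_complex R r) : ring_scope.

Lemma cmod_real (r : R) : 0 <= r -> cmod r%:C = r.
Proof. by move=> r_ge0; rewrite /cmod /= expr0n addr0 sqrtr_sqr ger0_norm. Qed.

Lemma cmod_ge0 (c : R[i]) : 0 <= cmod c.
Proof. by case: c => a b; rewrite /cmod /= sqrtr_ge0. Qed.

Lemma conj_real (r : R) : (r%:C : R[i])^* = r%:C.
Proof. by rewrite /Num.conj /= oppr0. Qed.

Lemma tau0 : tau 0 = 0.
Proof. by rewrite -(scale0r (0 : A)) (tau_scale CA) mul0r. Qed.

Lemma tauN (x : A) : tau (- x) = - tau x.
Proof. by rewrite -scaleN1r (tau_scale CA) mulN1r. Qed.

Lemma tauB (x y : A) : tau (x - y) = tau x - tau y.
Proof. by rewrite (tau_add CA) tauN. Qed.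

Lemma tau_sum (I : Type) (r : seq I) (P : pred I) (F : I -> A) :
  tau (\sum_(i <- r | P i) F i) = \sum_(i <- r | P i) tau (F i).
Proof. exact: (big_morph tau (tau_add CA) tau0). Qed.

Lemma star0 : star 0 = 0.
Proof. by rewrite -(scale0r (0 : A)) (star_scale CA) conjC0 !scale0r. Qed.

Lemma starN (x : A) : star (- x) = - star x.
Proof. by rewrite -scaleN1r (star_scale CA) rmorphN1 scaleN1r. Qed.

Lemma starB (x y : A) : star (x - y) = star x - star y.
Proof. by rewrite (star_add CA) starN. Qed.

Lemma star_sum (I : Type) (r : seq I) (P : pred I) (F : I -> A) :
  star (\sum_(i <- r | P i) F i) = \sum_(i <- r | P i) star (F i).
Proof. exact: (big_morph star (star_add CA) star0). Qed.

Lemma star1 : star 1 = 1.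
Proof.
by rewrite -[LHS]mulr1 -{2}(star_invol CA 1) -(star_mul CA) mulr1 (star_invol CA).
Qed.

Lemma nrm0 : nrm 0 = 0.
Proof.
rewrite -(scale0r (0 : A)) (nrm_scale CA).
by have /= -> := @cmod_real 0 (lexx _); rewrite mul0r.
Qed.

Lemma nrmZr (r : R) (x : A) : 0 <= r -> nrm (r%:C *: x) = r * nrm x.
Proof. by move=> r_ge0; rewrite (nrm_scale CA) cmod_real. Qed.

Lemma nrmN (x : A) : nrm (- x) = nrm x.
Proof.
rewrite -scaleN1r (nrm_scale CA) -(rmorphN1 (real_complex R)) /cmod /=.
by rewrite expr0n addr0 sqrtr_sqr normrN1 mul1r.
Qed.

Lemma nrmBC (x y : A) : nrm (x - y) = nrm (y - x).
Proof. by rewrite -opprB nrmN. Qed.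

Lemma nrm_star (x : A) : nrm (star x) = nrm x.
Proof.
suff H y : nrm y <= nrm (star y).
  by apply/eqP; rewrite eq_le H andbT -{2}(star_invol CA x) H.
have [->|y0] := eqVneq (nrm y) 0; first exact: (nrm_ge0 CA).
have yp : 0 < nrm y by rewrite lt_def y0 (nrm_ge0 CA).
by rewrite -(ler_pM2r yp) -expr2 -(nrm_Cstar CA) (nrm_submul CA).
Qed.

Lemma nrm1 : nrm 1 = 1.
Proof.
have H := nrm_Cstar CA 1; rewrite star1 mulr1 in H.
have [n0|n0] := eqVneq (nrm 1) 0.
  have := tau_unit CA; rewrite (nrm_eq0 CA n0) tau0 => /eqP.
  by rewrite eq_sym oner_eq0.
by apply: (mulfI n0); rewrite mulr1 -expr2.
Qed.

Lemma nrm_sqr_sa (x : A) : star x = x -> nrm (x * x) = nrm x ^+ 2.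
Proof. by move=> sx; rewrite -(nrm_Cstar CA) sx. Qed.

(** Convergence in the form used by [nrm_complete], since [A] carries no topology but only the
    function [nrm]. *)
Definition ncvg (u : nat -> A) (l : A) :=
  forall eps : R, 0 < eps -> exists N : nat, forall n : nat,
    (N <= n)%N -> nrm (u n - l) < eps.

Lemma eps_nrm0 (x : A) : (forall eps : R, 0 < eps -> nrm x <= eps) -> x = 0.
Proof.
move=> H; apply: (nrm_eq0 CA); apply/eqP; rewrite eq_le (nrm_ge0 CA) andbT.
by apply/ler_addgt0Pl => eps e0; rewrite addr0 H.
Qed.

Lemma ncvg_unique (u : nat -> A) (l l' : A) : ncvg u l -> ncvg u l' -> l = l'.
Proof.
move=> ul ul'; apply/eqP; rewrite -subr_eq0; apply/eqP; apply: eps_nrm0 => eps e0.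
have e2 : 0 < eps / 2 by rewrite divr_gt0.
have [N HN] := ul _ e2; have [N' HN'] := ul' _ e2.
have := HN (maxn N N') (leq_maxl _ _).
have := HN' (maxn N N') (leq_maxr _ _).
move: (u _) => x h' h.
have -> : l - l' = (l - x) + (x - l') by rewrite addrA subrK.
apply: le_trans (nrm_triangle CA _ _) _; rewrite (nrmBC l x); lra.
Qed.

Lemma ncvg_bound (u : nat -> A) (l : A) (M : R) :
  ncvg u l -> (forall n, nrm (u n) <= M) -> nrm l <= M.
Proof.
move=> ul uM; apply/ler_addgt0Pl => eps e0; have [N HN] := ul _ e0.
have -> : l = (l - u N) + u N by rewrite subrK.
apply: le_trans (nrm_triangle CA _ _) _; rewrite nrmBC.
by apply: lerD (uM N); rewrite ltW // HN.
Qed.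

Lemma ncvg_star (u : nat -> A) (l : A) :
  ncvg u l -> ncvg (fun n => star (u n)) (star l).
Proof.
by move=> ul eps /ul[N HN]; exists N => n /HN; rewrite -starB nrm_star.
Qed.

Lemma ncvg_lip (u : nat -> A) (l : A) (f : A -> A) (K : R) :
  0 <= K -> (forall n, nrm (f (u n) - f l) <= K * nrm (u n - l)) -> ncvg u l ->
  ncvg (f \o u) (f l).
Proof.
move=> K0 H ul eps e0; have K1 : 0 < K + 1 by lra.
have [N HN] := ul (eps / (K + 1)) (divr_gt0 e0 K1).
exists N => n /HN; rewrite ltr_pdivlMr // => lt; apply: le_lt_trans (H n) _.
have := nrm_ge0 CA (u n - l); nra.
Qed.

(** Records where limits live. The two instances are commutants, which make square roots commute
    with other elements, and [poly_closure S], which makes them approximable by polynomials in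
    [S]. *)
Record closed_subalg (B : A -> Prop) : Prop := {
  csub1 : B 1;
  csubD : forall x y, B x -> B y -> B (x + y);
  csubM : forall x y, B x -> B y -> B (x * y);
  csubZ : forall (c : R[i]) x, B x -> B (c *: x);
  csub_lim : forall u l, (forall n, B (u n)) -> ncvg u l -> B l }.

Lemma csubB B : closed_subalg B -> forall x y, B x -> B y -> B (x - y).
Proof.
by move=> cB x y Bx By; rewrite -scaleN1r; apply: csubD => //; apply: csubZ.
Qed.

Lemma commutant_closed (z : A) : closed_subalg (fun x => x * z = z * x).
Proof.
split=> [|x y xz yz|x y xz yz|c x xz|u l uz ul].
- by rewrite mulr1 mul1r.
- by rewrite mulrDl mulrDr xz yz.
- by rewrite -mulrA yz mulrA xz mulrA.
- by rewrite -scalerAl -scalerAr xz.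
apply: (@ncvg_unique (fun n => u n * z)).
  apply: (@ncvg_lip u l (fun x => x * z) (nrm z)) => //; first exact: nrm_ge0 CA _.
  by move=> n; rewrite -mulrBl mulrC (nrm_submul CA).
have -> : (fun n => u n * z) = (fun x => z * x) \o u by apply/funext => n /=.
apply: (@ncvg_lip u l (fun x => z * x) (nrm z)) => //; first exact: nrm_ge0 CA _.
by move=> n; rewrite -mulrBr (nrm_submul CA).
Qed.

(* Scalar majorant of the iteration [y |-> (h + y^2) / 2]. *)
Fixpoint rseq (n : nat) : R := if n is m.+1 then (1 + rseq m ^+ 2) / 2 else 0.

Lemma rseq_itv (n : nat) : 0 <= rseq n <= 1.
Proof. elim: n => [|n /andP[r0 r1]] /=; first lra.
move: (rseq n) r0 r1 => r r0 r1.
by have r2 : r ^+ 2 <= 1 by [rewrite expr_le1]; have := sqr_ge0 r; lra. Qed.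

(** In terms of [t = 1 - r] the recursion is [t - t^2 / 2], increasing for [t <= 1]. At
    [u = 2 / (n + 1)] its value is [2 n / (n + 1)^2], which is at most [2 / (n + 2)]. *)
Lemma rseq_rate (n : nat) : 1 - rseq n <= 2 / n.+1%:R.
Proof.
elim: n => [|n IH]; first by rewrite /= divr1; lra.
rewrite ler_pdivlMr // -natr1 in IH; rewrite ler_pdivlMr //= -(natr1 n.+1) -(natr1 n).
have /andP[r0 r1] := rseq_itv n; have n0 : 0 <= n%:R :> R by [].
move: (rseq n) (n%:R : R) r0 r1 n0 IH => d x r0 r1 n0 IH.
have [t tE] : {t : R | t = 1 - d} by exists (1 - d).
have -> : 1 - (1 + d ^+ 2) / 2 = t - t ^+ 2 / 2 by rewrite tE; field.
have {}IH : t * (x + 1) <= 2 by rewrite tE.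
have {r0 r1}t01 : t <= 1 by lra.
have t1 : t ^+ 2 >= 2 * t - 1 by have := sqr_ge0 (t - 1); rewrite sqrrB expr1n mulr1; lra.
(* For small [n] the bound [u] may exceed 1, outside the range of monotonicity; there the maximal
   value 1/2 of [t - t^2 / 2] is enough. *)
case: (lerP x 2) => x2.
  have : 0 <= (t ^+ 2 - (2 * t - 1)) * (x + 1 + 1) by apply: mulr_ge0; lra.
  lra.
have [u uE] : {u : R | u = 2 / (x + 1)} by exists (2 / (x + 1)).
have ux : u * (x + 1) = 2 by rewrite uE divfK //; lra.
have u0 : 0 <= u by rewrite uE; apply: divr_ge0; lra.
have u1 : u <= 1 by rewrite uE ler_pdivrMr; lra.
have tu : t <= u by rewrite uE ler_pdivlMr; lra.
have q : t ^+ 2 >= 2 * t * u - u ^+ 2 by have := sqr_ge0 (t - u); rewrite sqrrB; lra.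
have f : t - t ^+ 2 / 2 <= u - u ^+ 2 / 2.
  have : 0 <= (u - t) * (1 - u) by apply: mulr_ge0; lra.
  lra.
apply: le_trans (_ : (u - u ^+ 2 / 2) * (x + 1 + 1) <= _); first by rewrite ler_pM2r //; lra.
have -> : (u - u ^+ 2 / 2) * (x + 1 + 1) =
   u * (x + 1) + u - u * (u * (x + 1)) / 2 - u ^+ 2 / 2 by field.
rewrite ux; have := sqr_ge0 u; lra.
Qed.

Variable h : A.
Hypotheses (h_sa : star h = h) (h_le1 : nrm h <= 1).

(** A fixed point of this iteration satisfies [(1 - y)^2 = 1 - h]. *)
Fixpoint yseq (n : nat) : A :=
  if n is m.+1 then (2^-1 : R)%:C *: (h + yseq m * yseq m) else 0.

Lemma yseq_closed B n : closed_subalg B -> B h -> B (yseq n).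
Proof.
move=> cB Bh; elim: n => [|n IH] /=.
  by rewrite -(scale0r (1 : A)); apply: csubZ => //; apply: csub1.
by apply: csubZ => //; apply: csubD => //; apply: csubM.
Qed.

Lemma yseq_comm n : yseq n * h = h * yseq n.
Proof. exact: (yseq_closed n (commutant_closed h)). Qed.

Lemma yseq_sa n : star (yseq n) = yseq n.
Proof.
elim: n => [|n IH] /=; first exact: star0.
by rewrite (star_scale CA) conj_real (star_add CA) (star_mul CA) h_sa IH.
Qed.

Lemma yseq_le n : nrm (yseq n) <= rseq n.
Proof.
elim: n => [|n IH] /=; first by rewrite nrm0.
rewrite nrmZr ?invr_ge0 // mulrC ler_pM2r ?invr_gt0 //.
apply: le_trans (nrm_triangle CA _ _) (lerD h_le1 _).
rewrite expr2; apply: le_trans (nrm_submul CA _ _) _.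
by apply: ler_pM => //; apply: (nrm_ge0 CA).
Qed.

(** Consecutive iterates commute, so the difference of their squares factors as [(b - a) * (b + a)];
    the scalar sequence has the same factorization, and the bounds match factor by factor. *)
Lemma yseq_incr n : nrm (yseq n.+1 - yseq n) <= rseq n.+1 - rseq n.
Proof.
elim: n => [|n IH].
  rewrite /= subr0 mulr0 addr0 nrmZr ?invr_ge0 // expr0n addr0 subr0 mul1r.
  by rewrite ger_pMr ?invr_gt0.
rewrite [in X in X <= _]/= -scalerBr nrmZr ?invr_ge0 //.
set a := yseq n; set b := (2^-1)%:C *: _; rewrite -/(yseq n.+1) in b *.
have ab : a * b = b * a.
  by rewrite -scalerAl -scalerAr mulrDr mulrDl -/a -yseq_comm mulrA.
have -> : h + b * b - (h + a * a) = (b - a) * (b + a).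
  rewrite opprD addrACA subrr add0r mulrBl !mulrDr ab opprD addrA.
  by rewrite -[_ + _ - b * a]addrA subrr addr0.
have -> : rseq n.+2 - rseq n.+1 = 2^-1 * ((rseq n.+1 - rseq n) * (rseq n.+1 + rseq n)).
  have H (p q : R) : (1 + p ^+ 2) / 2 - (1 + q ^+ 2) / 2 = 2^-1 * ((p - q) * (p + q)) by field.
  exact: H (rseq n.+1) (rseq n).
rewrite ler_pM2l ?invr_gt0 //; apply: le_trans (nrm_submul CA _ _) _.
apply: ler_pM => //; try exact: (nrm_ge0 CA).
by apply: le_trans (nrm_triangle CA _ _) (lerD _ _); apply: yseq_le.
Qed.

Lemma yseq_dist m n : nrm (yseq (n + m) - yseq n) <= rseq (n + m) - rseq n.
Proof.
elim: m => [|m IH]; first by rewrite addn0 !subrr nrm0.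
rewrite addnS.
have -> : yseq (n + m).+1 - yseq n =
    (yseq (n + m).+1 - yseq (n + m)) + (yseq (n + m) - yseq n).
  by rewrite addrA subrK.
apply: le_trans (nrm_triangle CA _ _) _; have := yseq_incr (n + m); lra.
Qed.

Lemma yseq_cauchy (eps : R) : 0 < eps -> exists N : nat, forall m n : nat,
  (N <= m)%N -> (N <= n)%N -> nrm (yseq m - yseq n) < eps.
Proof.
(* Both [yseq m] and [yseq n] are compared with [yseq N], each at a cost of [2 / (N + 1)]; hence the
   4. *)
move=> e0; pose N := Num.bound (4 / eps).
have He : 2 * (2 / N.+1%:R) < eps.
  have : 4 / eps < N%:R by apply: archi_boundP; rewrite ltW // divr_gt0.
  rewrite ltr_pdivrMr // mulrA ltr_pdivrMr // -natr1; nra.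
have H k : (N <= k)%N -> nrm (yseq k - yseq N) <= 2 / N.+1%:R.
  move=> /subnKC <-; apply: le_trans (yseq_dist _ _) _.
  apply: le_trans (rseq_rate N); rewrite lerD2r.
  by case/andP: (rseq_itv (N + (k - N))).
exists N => m n /H Hm /H Hn.
have -> : yseq m - yseq n = (yseq m - yseq N) + (yseq N - yseq n).
  by rewrite addrA subrK.
apply: le_lt_trans (nrm_triangle CA _ _) _; rewrite (nrmBC (yseq N)).
by move: (2 / _) He Hm Hn => c; lra.
Qed.

Lemma sqrt_one_sub : exists y : A, [/\ star y = y, nrm y <= 1,
  (1 - y) * (1 - y) = 1 - h & forall B, closed_subalg B -> B h -> B y].
Proof.
have [y yl] := nrm_complete CA yseq_cauchy; rewrite -/(ncvg yseq y) in yl.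
have ysa : star y = y.
  apply: (@ncvg_unique yseq) => //.
  by have := ncvg_star yl; under eq_fun do rewrite yseq_sa.
have y1 : nrm y <= 1.
  by apply: (ncvg_bound yl) => n; apply: le_trans (yseq_le n) _; case/andP: (rseq_itv n).
exists y; split=> //; last first.
  by move=> B cB Bh; apply: (csub_lim cB _ yl) => n; apply: yseq_closed.
have fix_y : y = (2^-1 : R)%:C *: (h + y * y).
  apply: (@ncvg_unique (fun n => yseq n.+1)).
    by move=> eps /yl[N HN]; exists N => n Nn; apply: HN; apply: leqW.
  (* On the unit ball the map has Lipschitz constant 1, the factor 1/2 absorbing
     [nrm x + nrm y <= 2]. *)
  apply: (@ncvg_lip yseq y (fun x => (2^-1 : R)%:C *: (h + x * x)) 1) => // n.
  rewrite -scalerBr nrmZr ?invr_ge0 // opprD addrACA subrr add0r.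
  set x := yseq n.
  have -> : x * x - y * y = (x - y) * x + y * (x - y).
    by rewrite mulrBl mulrBr addrA subrK.
  have nx : nrm x <= 1 by apply: le_trans (yseq_le n) _; case/andP: (rseq_itv n).
  have n1 := nrm_submul CA (x - y) x; have n2 := nrm_submul CA y (x - y).
  have n3 := nrm_triangle CA ((x - y) * x) (y * (x - y)).
  have := nrm_ge0 CA (x - y); nra.
have : y + y = h + y * y.
  rewrite {1 2}fix_y -scalerDl -rmorphD (_ : 2^-1 + 2^-1 = 1 :> R); last by field.
  by rewrite rmorph1 scale1r.
move=> Hy; have -> : h = y + y - y * y by rewrite Hy addrK.
by rewrite mulrBl mul1r mulrBr mulr1 !opprD opprK !addrA.
Qed.

End CstarSqrt.

(** * Norm bounds from the trace *)

Section CstarNorm.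
Context (R : realType) (A : algType R[i]).
Variables (star : A -> A) (nrm : A -> R) (tau : A -> R[i]).
Hypothesis CA : Cstar_prob_space star nrm tau.

Local Notation "r %:C" := (real_complex R r) : ring_scope.
Local Notation closed_subalg := (closed_subalg nrm).

Lemma nrm_le_of_sqr_add (x z : A) (M : R) : 0 <= M -> star x = x -> star z = z ->
  x * z = z * x -> x * x + z * z = (M ^+ 2)%:C *: 1 -> nrm x <= M.
Proof.
move=> M0 sx sz xz xxzz; pose u := x + 'i *: z.
have su : star u = x - 'i *: z.
  by rewrite /u (star_add CA) (star_scale CA) sx sz conjCi scaleNr.
have uu : star u * u = (M ^+ 2)%:C *: 1.
  rewrite su /u mulrBl !mulrDr -!scalerAl -!scalerAr scalerA -(expr2 'i) sqrCi scaleN1r.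
  by rewrite xz -xxzz opprD opprK addrA addrK.
have nu : nrm u = M.
  apply/eqP; rewrite -(eqrXn2 (n := 2)) ?(nrm_ge0 CA) // -(nrm_Cstar CA) uu.
  by rewrite (nrmZr CA) ?sqr_ge0 // (nrm1 CA) mulr1.
have -> : x = (2^-1 : R)%:C *: (u + star u).
  rewrite su /u addrACA subrr addr0 -mulr2n -(scaler_nat 2 x) scalerA.
  by rewrite -(rmorph_nat (real_complex R)) -rmorphM mulVf ?pnatr_eq0 // rmorph1 scale1r.
rewrite (nrmZr CA) ?invr_ge0 //.
by have := nrm_triangle CA u (star u); rewrite (nrm_star CA) nu; lra.
Qed.

Lemma sqrt_one_sub_sa (h : A) : star h = h -> nrm h <= 1 ->
  exists c, [/\ star c = c, c * c = 1 - h &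
    forall B, closed_subalg B -> B h -> B c].
Proof.
move=> sh h1; have [y [sy y1 yy By]] := sqrt_one_sub CA sh h1.
exists (1 - y); split=> //; first by rewrite (starB CA) (star1 CA) sy.
by move=> B cB Bh; apply: (csubB cB); [exact: csub1 cB | exact: By].
Qed.

(* A fourth root of [a^2], that is, a square root of the absolute value of [a]. *)
Lemma sqrt_abs (a : A) : star a = a -> nrm a <= 1 ->
  exists c, [/\ star c = c, (c * c) * (c * c) = a * a &
    forall B, closed_subalg B -> B a -> B c].
Proof.
move=> sa a1.
have saa : star (a * a) = a * a by rewrite (star_mul CA) sa.
have na : nrm (a * a) <= 1 by rewrite (nrm_sqr_sa CA) // expr_le1 // (nrm_ge0 CA).
(* [z] only serves to show [nrm (1 - a * a) <= 1], where the triangle inequality would give 2: from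
   [a^2 + z^2 = 1] follows [nrm z <= 1]. *)
have [z [sz zz Bz]] := sqrt_one_sub_sa saa na.
have az : a * z = z * a.
  by apply/esym/(Bz _ (commutant_closed CA a)); rewrite mulrA.
have z1 : nrm (1 - a * a) <= 1.
  rewrite -zz (nrm_sqr_sa CA) // expr_le1 ?(nrm_ge0 CA) //.
  apply: (@nrm_le_of_sqr_add z a) => //.
  by rewrite zz subrK expr1n rmorph1 scale1r.
have s1 : star (1 - a * a) = 1 - a * a by rewrite (starB CA) (star1 CA) saa.
(* Here [1 - y] is the absolute value of [a], and [nrm y <= 1] allows a second root to be taken. *)
have [y [sy y1 yy By]] := sqrt_one_sub CA s1 z1.
have [c [sc cc Bc]] := sqrt_one_sub_sa sy y1.
exists c; split=> //; first by rewrite cc yy subKr.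
move=> B cB Ba; apply: Bc => //; apply: By => //; apply: (csubB cB).
  exact: csub1 cB.
exact: (csubM cB Ba Ba).
Qed.

Lemma tau_star_mul_ge0 (h b : A) : star h = h -> nrm h <= 1 ->
  0 <= tau (star b * (1 - h) * b).
Proof.
move=> sh h1; have [c [sc <- _]] := sqrt_one_sub_sa sh h1.
rewrite -{1}sc -mulrA -(mulrA (star c)) mulrA -(star_mul CA); exact: tau_pos CA _.
Qed.

Lemma tau_le_nrm (x : A) : star x = x -> tau x <= (nrm x)%:C.
Proof.
move=> sx; have [x0|x0] := eqVneq (nrm x) 0.
  by rewrite x0 (nrm_eq0 CA x0) (tau0 CA).
have xp : 0 < nrm x by rewrite lt_def x0 (nrm_ge0 CA).
pose h := (nrm x)^-1%:C *: x.
have sh : star h = h by rewrite (star_scale CA) conj_real sx.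
have nh : nrm h <= 1 by rewrite (nrmZr CA) ?invr_ge0 ?(nrm_ge0 CA) // mulVf.
have := tau_star_mul_ge0 1 sh nh.
rewrite (star1 CA) mulr1 mul1r (tauB CA) (tau_unit CA) (tau_scale CA) subr_ge0.
have np : 0 < (nrm x)%:C by rewrite ltcR.
by rewrite fmorphV ler_pdivrMl // mulr1.
Qed.

(** After scaling, [1 - star S * S / nrm S ^ 2] is the square of a self-adjoint element, so it has
    nonnegative trace against [y]. This makes [nrm S] a bound for left multiplication in the norm
    given by the trace. *)
Lemma sqnorm_mul_le (S y : A) :
  tau (star (S * y) * (S * y)) <= (nrm S ^+ 2)%:C * tau (star y * y).
Proof.
have [S0|S0] := eqVneq (nrm S) 0.
  by rewrite S0 (nrm_eq0 CA S0) mul0r mulr0 (tau0 CA) expr0n rmorph0 mul0r.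
have Sp : 0 < nrm S by rewrite lt_def S0 (nrm_ge0 CA).
pose h := ((nrm S) ^+ 2)^-1%:C *: (star S * S).
have sh : star h = h.
  by rewrite (star_scale CA) conj_real (star_mul CA) (star_invol CA).
have nh : nrm h <= 1.
  rewrite (nrmZr CA) ?invr_ge0 ?sqr_ge0 // (nrm_Cstar CA) mulVf //.
  by rewrite expf_neq0.
have := tau_star_mul_ge0 y sh nh.
rewrite mulrBr mulr1 mulrBl (tauB CA) subr_ge0 /h -scalerAr -scalerAl (tau_scale CA).
have np : 0 < (nrm S ^+ 2)%:C by rewrite ltcR exprn_gt0.
by rewrite fmorphV ler_pdivrMl // (star_mul CA) !mulrA.
Qed.

Definition poly_closure (S x : A) : Prop :=
  forall eps : R, 0 < eps -> exists p : {poly R[i]}, nrm (x - horner_alg S p) < eps.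

Lemma poly_closure_closed (S : A) : closed_subalg (poly_closure S).
Proof.
split=> [eps e0|x y Bx By eps e0|x y Bx By eps e0|c x Bx eps e0|u l Bu ul eps e0].
- by exists 1; rewrite rmorph1 subrr (nrm0 CA).
- have e2 : 0 < eps / 2 by rewrite divr_gt0.
  have [p Hp] := Bx _ e2; have [q Hq] := By _ e2; exists (p + q).
  rewrite raddfD /= opprD addrACA; apply: le_lt_trans (nrm_triangle CA _ _) _; lra.
(* With [a], [b] within [d] of [x], [y], the error [(x - a) * y + a * (y - b)] is at most [d * K];
   [d <= 1] gives [nrm a <= nrm x + 1]. *)
- pose K := nrm x + nrm y + 1.
  have x0 := nrm_ge0 CA x; have y0 := nrm_ge0 CA y.
  have K0 : 0 < K by rewrite /K; lra.
  pose d := Num.min 1 (eps / (2 * K)).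
  have d0 : 0 < d by rewrite lt_min ltr01 divr_gt0 // mulr_gt0.
  have d1 : d <= 1 by rewrite ge_min lexx.
  have dK : d * K <= eps / 2.
    apply: le_trans (_ : eps / (2 * K) * K <= _); last first.
      by rewrite invfM mulrA divfK ?gt_eqF.
    by rewrite ler_pM2r // ge_min lexx orbT.
  have [p Hp] := Bx _ d0; have [q Hq] := By _ d0; exists (p * q).
  rewrite rmorphM /=; move: (horner_alg S p) (horner_alg S q) Hp Hq => a b Hp Hq.
  have -> : x * y - a * b = (x - a) * y + (x - (x - a)) * (y - b).
    by rewrite subKr mulrBl mulrBr addrA subrK.
  have na : nrm (x - (x - a)) <= nrm x + 1.
    by apply: le_trans (nrm_triangle CA _ _) _; rewrite (nrmN CA); lra.
  apply: le_lt_trans (nrm_triangle CA _ _) _.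
  have n1 := nrm_submul CA (x - a) y; have n2 := nrm_submul CA (x - (x - a)) (y - b).
  have m1 : nrm (x - a) * nrm y <= d * nrm y by rewrite ler_wpM2r // ltW.
  have m2 : nrm (x - (x - a)) * nrm (y - b) <= (nrm x + 1) * d.
    by apply: ler_pM => //; try exact: (nrm_ge0 CA); rewrite ltW.
  have : d * nrm y + (nrm x + 1) * d = d * K by rewrite /K; ring.
  by move: (nrm ((x - a) * y)) (nrm (_ * (y - b))) n1 n2 => r1 r2; lra.
- have K0 : 0 < cmod c + 1.
    by have := cmod_ge0 c; lra.
  have [p Hp] := Bx _ (divr_gt0 e0 K0); exists (c *: p).
  have -> : horner_alg S (c *: p) = c *: horner_alg S p by rewrite linearZ /= -scalerAl mul1r.
  rewrite -scalerBr (nrm_scale CA).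
  rewrite ltr_pdivlMr // in Hp; apply: le_lt_trans Hp.
  by rewrite mulrC ler_wpM2l ?(nrm_ge0 CA) // lerDl.
- have e2 : 0 < eps / 2 by rewrite divr_gt0.
  have [N HN] := ul _ e2; have [p Hp] := Bu N _ e2; exists p.
  have -> : l - horner_alg S p = (l - u N) + (u N - horner_alg S p).
    by rewrite addrA subrK.
  have := HN N (leqnn N); rewrite (nrmBC CA).
  by have := nrm_triangle CA (l - u N) (u N - horner_alg S p); lra.
Qed.

(* With [k = M^2 - S^2] and [a = k / |k|], faithfulness forces [a = |a|], so [k]
   is a square. *)
Lemma nrm_le_of_sqnorm_mul (S : A) (M : R) : 0 <= M -> star S = S ->
  (forall p : {poly R[i]}, let y := horner_alg S p in
     tau (star (S * y) * (S * y)) <= (M ^+ 2)%:C * tau (star y * y)) ->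
  nrm S <= M.
Proof.
move=> M0 sS H; pose k := (M ^+ 2)%:C *: 1 - S * S.
have sk : star k = k.
  by rewrite (starB CA) (star_scale CA) conj_real (star1 CA) (star_mul CA) sS.
have kS : k * S = S * k.
  by rewrite mulrBl mulrBr -scalerAl -scalerAr mul1r mulr1 mulrA.
have [k0|k0] := eqVneq (nrm k) 0.
  have /eqP := nrm_eq0 CA k0; rewrite subr_eq0 => /eqP SS.
  apply: (@nrm_le_of_sqr_add S 0) => //; rewrite ?mul0r ?mulr0 ?addr0 //.
  exact: star0 CA.
have kp : 0 < nrm k by rewrite lt_def k0 (nrm_ge0 CA).
have kpos p : 0 <= tau (star (horner_alg S p) * k * horner_alg S p).
  move: (H p); cbv zeta; move: (horner_alg S p) => y.
  rewrite -subr_ge0 (star_mul CA) sS /k mulrBr mulrBl (tauB CA).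
  by rewrite -scalerAr -scalerAl mulr1 (tau_scale CA) !mulrA.
have kpos_cl m : poly_closure S m -> 0 <= tau (star m * k * m).
  move=> Bm.
  (* In the order of [R[i]] a single inequality already forces the imaginary part to vanish; the
     real part then follows by letting [eps] tend to 0. *)
  suff Heps (eps : R) : 0 < eps -> - eps%:C <= tau (star m * k * m).
    have sm : star (star m * k * m) = star m * k * m.
      by rewrite !(star_mul CA) (star_invol CA) sk mulrA.
    have : - 1%:C <= tau (star m * k * m) by exact: Heps.
    case: (tau _) Heps => re im Heps; rewrite !lecE /= => /andP[/eqP im0 _].
    rewrite im0 oppr0 eqxx /=; apply/ler_addgt0Pl => eps /Heps.
    by rewrite lecE /= => /andP[_]; rewrite -subr_ge0 opprK addrC.
  (* [K] is [nrm m + (nrm m + 1)], from the two terms [star (y - m) * k * m] and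
     [star y * k * (y - m)] of the error. *)
  move=> e0; pose K := 2 * nrm m + 1; have m0 := nrm_ge0 CA m.
  have K0 : 0 < K by rewrite /K; lra.
  pose d := Num.min 1 (eps / (nrm k * K)).
  have d0 : 0 < d by rewrite lt_min ltr01 divr_gt0 // mulr_gt0.
  have d1 : d <= 1 by rewrite ge_min lexx.
  have dK : d * (nrm k * K) <= eps.
    by rewrite -ler_pdivlMr ?mulr_gt0 // ge_min lexx orbT.
  have [p Hp] := Bm _ d0; have := kpos p; move: (horner_alg S p) Hp => y Hy y0.
  pose D := star y * k * y - star m * k * m.
  have sD : star D = D.
    by rewrite (starB CA) !(star_mul CA) !(star_invol CA) sk !mulrA.
  have nD : nrm D <= eps.
    have -> : D = star (y - m) * k * m + star y * k * (y - m).
      by rewrite (starB CA) !mulrBl (mulrBr (star y * k)) [RHS]addrC addrA subrK.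
    have ny : nrm y <= nrm m + 1.
      have -> : y = m - (m - y) by rewrite subKr.
      by apply: le_trans (nrm_triangle CA _ _) _; rewrite (nrmN CA); lra.
    apply: le_trans (nrm_triangle CA _ _) _; apply: le_trans dK.
    have dy : nrm (y - m) <= d by rewrite (nrmBC CA) ltW.
    have bound x z : nrm (star x * k * z) <= nrm x * nrm k * nrm z.
      apply: le_trans (nrm_submul CA _ _) _; rewrite ler_wpM2r ?(nrm_ge0 CA) //.
      by apply: le_trans (nrm_submul CA _ _) _; rewrite (nrm_star CA).
    have m1 : nrm (y - m) * nrm k * nrm m <= d * nrm k * nrm m.
      by rewrite -!mulrA ler_wpM2r ?mulr_ge0 ?(nrm_ge0 CA).
    have m2 : nrm y * nrm k * nrm (y - m) <= (nrm m + 1) * nrm k * d.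
      by apply: ler_pM => //; rewrite ?mulr_ge0 ?(nrm_ge0 CA) // ler_wpM2r // (nrm_ge0 CA).
    have b1 := bound (y - m) m; have b2 := bound y (y - m).
    have : d * (nrm k * K) = d * nrm k * nrm m + (nrm m + 1) * nrm k * d by rewrite /K; ring.
    by move: (nrm (star _ * k * m)) (nrm (star y * k * _)) b1 b2 => r1 r2; lra.
  have := tau_le_nrm sD; rewrite /D (tauB CA) lerBlDr => HD.
  have := le_trans y0 HD; rewrite -subr_ge0 => H0.
  rewrite -subr_ge0 opprK addrC; apply: le_trans H0 _.
  by rewrite subr0 lerD2r lecR.
pose a := (nrm k)^-1%:C *: k.
have ka : k = (nrm k)%:C *: a by rewrite scalerA -rmorphM mulfV // rmorph1 scale1r.
have sa : star a = a by rewrite (star_scale CA) conj_real sk.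
have na : nrm a <= 1 by rewrite (nrmZr CA) ?invr_ge0 ?(nrm_ge0 CA) // mulVf.
have [c [sc cc Bc]] := sqrt_abs sa na.
have ca : c * a = a * c by apply: (Bc _ (commutant_closed CA a)).
have cS : c * S = S * c.
  by apply: (Bc _ (commutant_closed CA S)); rewrite -scalerAl -scalerAr kS.
have BS : poly_closure S S.
  by move=> eps e0; exists 'X; rewrite horner_algX subrr (nrm0 CA).
have clS := poly_closure_closed S.
have Ba : poly_closure S a.
  apply: (csubZ clS); apply: (csubB clS); last exact: (csubM clS BS BS).
  by apply: (csubZ clS); exact: csub1 clS.
(* As [c * c] is the absolute value of [a], this is twice the negative part of [a]; the goal is that
   it vanishes. *)
pose m := c * c - a.
have sm : star m = m by rewrite (starB CA) (star_mul CA) sc sa.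
have Bm : poly_closure S m.
  by have Bcc := Bc _ clS Ba; exact: (csubB clS (csubM clS Bcc Bcc) Ba).
have cm : c * m = m * c by rewrite mulrBr mulrBl ca !mulrA.
have gm : c * c * m = - (a * m).
  rewrite /m !mulrBr cc; have -> : c * c * a = a * (c * c).
    by rewrite -mulrA ca mulrA ca -mulrA.
  by rewrite opprB.
(* Positivity at [m] gives [0 <= tau (m * a * m)], while [gm] turns [m * a * m] into
   [- star (c * m) * (c * m)]; faithfulness concludes. *)
have cm0 : c * m = 0.
  apply: (tau_faithful CA); apply/eqP; rewrite eq_le (tau_pos CA) andbT.
  have := kpos_cl _ Bm; rewrite sm ka -scalerAr -scalerAl (tau_scale CA).
  have np : 0 < (nrm k)%:C by rewrite ltcR.
  rewrite pmulr_rge0 // -mulrA (_ : a * m = - (c * c * m)); last by rewrite gm opprK.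
  by rewrite mulrN (tauN CA) oppr_ge0 (star_mul CA) sc sm !mulrA.
have m0 : m = 0.
  apply: (tau_faithful CA); rewrite sm.
  have -> : m * m = c * c * m - a * m by rewrite {1}/m mulrBl.
  have -> : a * m = - (c * c * m) by rewrite gm opprK.
  by rewrite opprK -!mulrA cm0 mulr0 addr0 (tau0 CA).
have ac : a = c * c by apply/esym/eqP; rewrite -subr_eq0; apply/eqP.
(* Since [c * c = a], the square of [z] is [nrm k] times [a], that is [k]. *)
pose z := (Num.sqrt (nrm k))%:C *: c.
apply: (@nrm_le_of_sqr_add S z) => //.
- by rewrite (star_scale CA) conj_real sc.
- by rewrite -scalerAl -scalerAr cS.
- rewrite /z -scalerAl -scalerAr scalerA -rmorphM.
  rewrite -(expr2 (Num.sqrt _)) sqr_sqrtr ?(nrm_ge0 CA) //.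
  by rewrite -ac -ka addrC subrK.
Qed.

End CstarNorm.

(** * Differential equation of the Chebyshev polynomials *)

Section Chebyshev.
Context (R : realType).

(* Chebyshev polynomials of the second kind rescaled to [-2, 2], orthonormal for
   the semicircle law. *)
Fixpoint cheb (n : nat) : {poly R} :=
  if n is m.+1 then 'X * cheb m - (if m is k.+1 then cheb k else 0) else 1.

(** The two relations are stated together because the three-term recursion propagates them only as a
    pair. *)
Lemma cheb_deriv_rec (n : nat) :
  'X * (cheb n.+1)^`() = n.+1%:R * cheb n.+1 + 2 * (cheb n)^`() /\
  2 * (cheb n.+1)^`() = 'X * (cheb n)^`() + n.+2%:R * cheb n.
Proof.
elim: n => [|n [IHc IHd]].
  by rewrite /= subr0 mulr1 derivX -polyC1 derivC !mulr0 addr0 add0r !mulr1 mul1r.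
have dE : (cheb n.+2)^`() = cheb n.+1 + 'X * (cheb n.+1)^`() - (cheb n)^`().
  by rewrite -[cheb n.+2]/('X * cheb n.+1 - cheb n) derivB derivM derivX mul1r.
have cE : cheb n.+2 = 'X * cheb n.+1 - cheb n by [].
rewrite dE cE; move: (cheb n.+1) (cheb n) IHc IHd => U V.
move: (U^`()) (V^`()) => dU dV IHc IHd.
rewrite -!(natr1 n.+2) -!(natr1 n.+1) in IHd *.
move: (n.+1%:R : {poly R}) IHc IHd => k IHc IHd.
move/eqP: IHc; rewrite -subr_eq0 => /eqP IHc; move/eqP: IHd; rewrite -subr_eq0 => /eqP IHd.
split; apply/eqP; rewrite -subr_eq0; apply/eqP.
  rewrite -[RHS](_ : 'X * ('X * dU - (k * U + 2 * dV))
    - (2 * dU - ('X * dV + (k + 1) * V)) = 0); first by ring.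
  by rewrite IHc IHd mulr0 subr0.
by rewrite -[RHS]IHc; ring.
Qed.

Lemma cheb_ode (n : nat) : (4 - 'X ^+ 2) * (cheb n.+1)^`()^`()
  - 3 * 'X * (cheb n.+1)^`() = - (n.+1%:R * n.+3%:R) * cheb n.+1.
Proof.
have [c d] := cheb_deriv_rec n.
have c' := congr1 deriv c; have d' := congr1 deriv d.
move: c c' d d'; move: (cheb n.+1) (cheb n) => U V.
have dn k : (k%:R : {poly R})^`() = 0 by rewrite -polyC_natr derivC.
rewrite !(derivD, derivM, derivX, dn) !mul0r !mul1r !add0r => c c' d d'.
move: (U^`()) (V^`()) c c' d d' => dU dV.
move: (dU^`()) (dV^`()) => d2U d2V c c' d d'.
rewrite -(natr1 n.+2) -!(natr1 n.+1) in d d' *.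
move: (n.+1%:R : {poly R}) c c' d d' => k c c' d d'.
move/eqP: c; rewrite -subr_eq0 => /eqP c; move/eqP: c'; rewrite -subr_eq0 => /eqP c'.
move/eqP: d'; rewrite -subr_eq0 => /eqP d'; apply/eqP; rewrite -subr_eq0; apply/eqP.
(* Twice the derivative of the second relation, minus ['X] times the derivative of the first, minus
   [n + 3] times the first: every term in [V] cancels. *)
rewrite -[RHS](_ : 2 * (2 * d2U - (dV + 'X * d2V + (k + 1) * dV))
  - 'X * (dU + 'X * d2U - (k * dU + 2 * d2V))
  - (k + 1 + 1) * ('X * dU - (k * U + 2 * dV)) = 0); first by ring.
by rewrite c c' d' !mulr0 !subr0.
Qed.

End Chebyshev.

(** * Chebyshev polynomials are centered for the semicircle law *)

Section Semicircle.
Context (R : realType).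

Definition semicircle_mean (q : {poly R}) : R :=
  Rintegral (@lebesgue_measure R) `[(-2)%R, 2%R] (fun x => q.[x] * semicircle_density x).

Lemma semicircle_density_continuous : continuous (@semicircle_density R).
Proof.
move=> x; apply: cvgM; last exact: cvg_cst.
apply: (@continuous_comp _ _ _ (fun x : R => 4 - x ^+ 2) Num.sqrt).
  apply: cvgB; first exact: cvg_cst.
  exact: exprn_continuous.
exact: sqrt_continuous.
Qed.

Lemma semicircle_integrable (q : {poly R}) :
  (@lebesgue_measure R).-integrable `[(-2)%R, 2%R]
    (EFin \o (fun x => q.[x] * semicircle_density x)).
Proof.
apply: continuous_compact_integrable; first exact: segment_compact.
apply: continuous_subspaceT => x; apply: cvgM; first exact: continuous_horner.
exact: semicircle_density_continuous.
Qed.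

Lemma semicircle_meanD (p q : {poly R}) :
  semicircle_mean (p + q) = semicircle_mean p + semicircle_mean q.
Proof.
rewrite /semicircle_mean -RintegralD //; try exact: semicircle_integrable.
by apply: eq_Rintegral => x _; rewrite hornerD mulrDl.
Qed.

Lemma semicircle_meanZ (c : R) (q : {poly R}) :
  semicircle_mean (c *: q) = c * semicircle_mean q.
Proof.
rewrite /semicircle_mean -RintegralZl //; last exact: semicircle_integrable.
by apply: eq_Rintegral => x _; rewrite hornerZ -mulrA.
Qed.

(* Integrates the derivative of [p(x) (4 - x^2)^(3/2)], which vanishes at both
   end points. *)
Lemma semicircle_mean_deriv (p : {poly R}) :
  semicircle_mean ((4 - 'X ^+ 2) * p^`() - 3 * 'X * p) = 0.
Proof.
pose w : {poly R} := 4 - 'X ^+ 2.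
have wE x : w.[x] = 4 - x ^+ 2 by rewrite /w -polyC_natr hornerD hornerN hornerC hornerXn.
pose F := (fun x : R => (p * w).[x]) \* (Num.sqrt \o (fun x : R => w.[x])).
have cF : continuous F.
  move=> x; apply: cvgM; first exact: continuous_horner.
  by apply: continuous_comp; [exact: continuous_horner | exact: sqrt_continuous].
(* The product rule is applied inside the interval only, since the square root factor is not
   differentiable at the end points; there [continuous_FTC2] asks for one-sided continuity. *)
have dF (x : R) : -2 < x < 2 -> is_derive x 1 F
    (((4 - 'X ^+ 2) * p^`() - 3 * 'X * p).[x] * Num.sqrt (4 - x ^+ 2)).
  case/andP=> x2 x2'; have w0 : 0 < w.[x] by rewrite wE; nra.
  have dw : w^`() = - (2 * 'X).
    have d4 : (4 : {poly R})^`() = 0 by rewrite -polyC_natr derivC.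
    by rewrite /w derivB derivXn d4 sub0r expr1 mulr_natl.
  have D1 := is_derive_poly (p * w) x; have D2 := is_derive_poly w x.
  have D3 := is_derive1_sqrt w0.
  have D4 := @is_derive1_comp _ _ _ _ _ _ D3 D2.
  have D5 := is_deriveM D1 D4.
  have -> : F = horner (p * w) * (Num.sqrt \o horner w) by [].
  apply: (is_derive_eq D5).
  have s0 : Num.sqrt w.[x] != 0 by rewrite sqrtr_eq0 -ltNge.
  have hn k : (k%:R : {poly R}).[x] = k%:R by rewrite -polyC_natr hornerC.
  have e2 : (p * w)^`().[x] = p^`().[x] * w.[x] + p.[x] * - (2 * x).
    by rewrite derivM dw hornerD !hornerM hornerN hornerM hn hornerX.
  have e3 : (w * p^`() - 3 * 'X * p).[x] = w.[x] * p^`().[x] - 3 * x * p.[x].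
    by rewrite hornerD hornerN !hornerM hn hornerX.
  have e4 : w^`().[x] = - (2 * x) by rewrite dw hornerN hornerM hn hornerX.
  rewrite e2 -[4 - 'X ^+ 2]/w e3 e4 hornerM -wE /=.
  move: (w.[x]) (p.[x]) (p^`().[x]) s0 (sqr_sqrtr (ltW w0)) => y a b.
  move: (Num.sqrt y) => u u0 <-; rewrite /GRing.scale /=; field.
  by rewrite u0.
pose f x := ((4 - 'X ^+ 2) * p^`() - 3 * 'X * p).[x] * Num.sqrt (4 - x ^+ 2).
have cf : continuous f.
  move=> x; apply: cvgM; first exact: continuous_horner.
  apply: (@continuous_comp _ _ _ (fun x : R => 4 - x ^+ 2) Num.sqrt).
    by apply: cvgB; [exact: cvg_cst | exact: exprn_continuous].
  exact: sqrt_continuous.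
have := @continuous_FTC2 R f F (-2) 2.
have -> : F (-2) = 0 by rewrite /F /= !wE sqrrN -natrX subrr sqrtr0 mulr0.
have -> : F 2 = 0 by rewrite /F /= !wE -natrX subrr sqrtr0 mulr0.
rewrite subee // => FTC.
have If : Rintegral (@lebesgue_measure R) `[(-2)%R, 2%R] f = 0.
  rewrite /Rintegral FTC //; first lra.
  - exact: continuous_subspaceT.
  - split.
    + by move=> x; rewrite in_itv /= => /dF/@ex_derive.
    + by apply: cvg_at_right_filter; apply: cF.
    + by apply: cvg_at_left_filter; apply: cF.
  - by move=> x; rewrite in_itv /= => /dF D; rewrite derive1E; apply: derive_val.
rewrite -[RHS](mul0r (2 * pi)^-1) -If -RintegralZr //.
  by apply: eq_Rintegral => x _; rewrite /semicircle_density mulrA.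
apply: continuous_compact_integrable; first exact: segment_compact.
exact: continuous_subspaceT.
Qed.

(** By [cheb_ode] this polynomial, times the nonzero constant [- (n + 1) (n + 3)], has the form
    treated in [semicircle_mean_deriv], with its own derivative as [p]. *)
Lemma semicircle_mean_cheb (n : nat) : semicircle_mean (cheb R n.+1) = 0.
Proof.
have := semicircle_mean_deriv (cheb R n.+1)^`().
rewrite cheb_ode -natrM -mulNrn -mulr_natr.
rewrite -polyC1 -polyCN -polyC_natr -polyCM mul_polyC semicircle_meanZ => /eqP.
rewrite mulf_eq0 mulN1r oppr_eq0 pnatr_eq0 muln_eq0 /=.
by move/eqP.
Qed.

Section SemicircleVariable.
Context (A : algType R[i]) (star : A -> A) (nrm : A -> R) (tau : A -> R[i]).
Hypothesis CA : Cstar_prob_space star nrm tau.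
Variable s : A.
Hypothesis sc_s : semicircle_variable star tau s.

Lemma tau_semicircle (q : {poly R}) :
  tau (horner_alg s (map_poly (real_complex R) q)) = real_complex R (semicircle_mean q).
Proof.
elim/poly_ind: q => [|q c IH]; last clear IH.
  rewrite rmorph0 rmorph0 (tau0 CA) -[X in semicircle_mean X](scale0r 0) semicircle_meanZ.
  by rewrite mul0r rmorph0.
set p := _ + _; rewrite -[p]coefK poly_def.
have mean0 : semicircle_mean 0 = 0.
  by rewrite -[X in semicircle_mean X](scale0r 0) semicircle_meanZ mul0r.
rewrite (big_morph semicircle_mean semicircle_meanD mean0) !rmorph_sum (tau_sum CA).
apply: eq_bigr => i _ /=; rewrite semicircle_meanZ map_polyZ map_polyXn.
rewrite -mul_polyC rmorphM /= horner_algC rmorphXn /= horner_algX -scalerAl mul1r.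
rewrite (tau_scale CA) sc_s.2 rmorphM; congr (_ * real_complex R _).
by apply: eq_Rintegral => x _; rewrite hornerXn.
Qed.

Lemma tau_cheb (n : nat) :
  tau (horner_alg s (map_poly (real_complex R) (cheb R n.+1))) = 0.
Proof. by rewrite tau_semicircle semicircle_mean_cheb rmorph0. Qed.

End SemicircleVariable.
End Semicircle.

(** * The orthonormal family indexed by words *)

Section ChebyshevWords.
Context (R : realType) (A : algType R[i]).
Variables (star : A -> A) (nrm : A -> R) (tau : A -> R[i]).
Hypothesis CA : Cstar_prob_space star nrm tau.
Context (L : nat) (e : rel 'I_L) (s : 'I_L -> A).
Hypotheses (e_sym : symmetric e) (e_irr : irreflexive e).
Hypothesis sc_s : forall i, semicircle_variable star tau (s i).
Hypothesis ind_s : G_independent_variables star tau e s.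

Notation word := (seq 'I_L).

(** The fuel [n] is there because [lrem v w'] is not a subterm of [w]; it never runs out when
    [size w <= n]. *)
Fixpoint xi_rec (n : nat) (w : word) : A :=
  if n is m.+1 then
    if w is v :: w' then
      s v * xi_rec m w' - (if ldiv e v w' then xi_rec m (lrem v w') else 0)
    else 1
  else 1.

(* The orthonormal family: [xi] of a word with blocks [v_j^k_j] in normal form
   is the product of the [U_k_j (s v_j)]. *)
Definition xi (w : word) : A := xi_rec (size w) w.

Lemma lrem_size_le (v : 'I_L) (w : word) : (size (lrem v w) <= size w)%N.
Proof. by elim: w => //= u w IH; case: ifP. Qed.

Lemma xi_rec_size (n : nat) (w : word) : (size w <= n)%N -> xi_rec n w = xi w.
Proof.
rewrite /xi; suff H k : (size w <= n)%N -> (size w <= k)%N -> xi_rec n w = xi_rec k w.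
  by move=> wn; apply: H.
elim: n k w => [|n IH] [|k] [|v w] //=; rewrite !ltnS => wn wk.
have rn := leq_trans (lrem_size_le v w) wn.
have rk := leq_trans (lrem_size_le v w) wk.
by rewrite (IH k) // (IH k (lrem v w)).
Qed.

Lemma xi_cons (v : 'I_L) (w : word) :
  xi (v :: w) = s v * xi w - (if ldiv e v w then xi (lrem v w) else 0).
Proof. by rewrite {1}/xi /= xi_rec_size // xi_rec_size // lrem_size_le. Qed.

Lemma mul_xi (v : 'I_L) (w : word) :
  s v * xi w = xi (v :: w) + (if ldiv e v w then xi (lrem v w) else 0).
Proof. by rewrite xi_cons subrK. Qed.

Lemma generated_gen (i : 'I_L) : generated_star_subalgebra star (s i) (s i).
Proof. by move=> S _. Qed.

Lemma generated_horner (i : 'I_L) (p : {poly R[i]}) :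
  generated_star_subalgebra star (s i) (horner_alg (s i) p).
Proof.
move=> S [S1 SD SM SZ _] Ss; elim/poly_ind: p => [|p c IH].
  by rewrite rmorph0 -(scale0r (1 : A)); apply: SZ.
by rewrite rmorphD rmorphM /= horner_algX horner_algC; apply: SD (SM _ _ IH Ss) (SZ _ _ S1).
Qed.

Lemma s_comm (u v : 'I_L) : e u v -> s u * s v = s v * s u.
Proof.
by move=> /ind_s.1/(_ (s u) (s v)) []; try exact: generated_gen.
Qed.

Lemma xi_swap (u v : 'I_L) (w : word) : e u v -> xi (u :: v :: w) = xi (v :: u :: w).
Proof.
(* Expanding both letters gives a formula in which exchanging [x] and [y] swaps the two middle terms
   and fixes the others, by [s_comm] and [lremC]. *)
have F x y : e x y -> xi (x :: y :: w) = s x * s y * xi w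
    - s x * (if ldiv e y w then xi (lrem y w) else 0)
    - (if ldiv e x w then s y * xi (lrem x w) else 0)
    + (if ldiv e x w && ldiv e y w then xi (lrem y (lrem x w)) else 0).
  move=> exy; have yx : (y == x) = false by apply: contraTF exy => /eqP->; rewrite e_irr.
  rewrite xi_cons /= yx [e y x]e_sym exy xi_cons mulrBr mulrA /=.
  case: (boolP (ldiv e x w)) => dx /=; last by rewrite !subr0 addr0.
  by rewrite xi_cons (ldiv_lrem e_irr exy dx) opprB addrCA addrC.
move=> euv; have evu : e v u by rewrite e_sym.
rewrite !F // (s_comm euv) andbC (lremC u v); congr (_ + _).
rewrite -!addrA; congr (_ + _); rewrite addrC.
by congr (- _ + - _); case: ifP; rewrite ?mulr0.
Qed.

Lemma xi_step (w x : word) : trace_step e w x -> xi w = xi x.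
Proof.
have [n] := ubnP (size w); elim: n w x => // n IH w x.
move=> wn [[|c a] [b [u [v [euv [wE xE]]]]]]; subst w x; first exact: xi_swap.
have st : trace_step e (a ++ u :: v :: b) (a ++ v :: u :: b).
  by exists a, b, u, v.
rewrite /= ltnS in wn; rewrite /= !xi_cons (IH _ _ _ st) // (ldiv_step e_sym c st).
case: (lrem_step c st) => [-> //|st'].
by rewrite (IH _ _ _ st') // (leq_ltn_trans (lrem_size_le _ _)).
Qed.

Lemma xi_trace (w x : word) : trace_equiv e w x -> xi w = xi x.
Proof. by elim=> {w x} [w x /xi_step|w|w x _ ->|w x y _ -> _ ->]. Qed.

Definition chebs (v : 'I_L) (k : nat) : A :=
  horner_alg (s v) (map_poly (real_complex R) (cheb R k)).

Lemma chebs0 (v : 'I_L) : chebs v 0 = 1.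
Proof. by rewrite /chebs rmorph1 rmorph1. Qed.

Lemma chebs_rec (v : 'I_L) (k : nat) :
  chebs v k.+2 = s v * chebs v k.+1 - chebs v k.
Proof.
rewrite /chebs -[cheb R k.+2]/('X * cheb R k.+1 - cheb R k).
move: (cheb R k.+1) (cheb R k) => U V.
by rewrite !rmorphB !rmorphM /= map_polyX horner_algX.
Qed.

Lemma chebs1 (v : 'I_L) : chebs v 1 = s v.
Proof. by rewrite /chebs /= subr0 mulr1 map_polyX horner_algX. Qed.

(** Dividing [v^(k+1) w] by [v] leaves [v^k w], so the recursion of [xi] becomes that of [cheb]. It
    needs two consecutive values, hence the paired induction; [v] not dividing [w] gives the
    start. *)
Lemma xi_power (v : 'I_L) (k : nat) (w : word) : ~~ ldiv e v w ->
  xi (nseq k v ++ w) = chebs v k * xi w.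
Proof.
move=> nd; suff [] : xi (nseq k v ++ w) = chebs v k * xi w /\
  xi (nseq k.+1 v ++ w) = chebs v k.+1 * xi w by [].
elim: k => [|k [IH1 IH2]].
  by rewrite /= chebs0 mul1r xi_cons (negPf nd) subr0 chebs1.
split=> //; rewrite -[nseq k.+2 v ++ w]/(v :: (nseq k.+1 v ++ w)) xi_cons IH2.
by rewrite /= eqxx /= IH1 chebs_rec mulrBl mulrA.
Qed.

Lemma xi_block (bs : seq ('I_L * nat)) : adm e [seq b.1 | b <- bs] ->
  xi (block_word bs) = \prod_(b <- bs) chebs b.1 b.2.+1.
Proof.
elim: bs => [|b bs IH] /=; first by rewrite big_nil.
move=> /andP[nd abs]; rewrite big_cons -IH //.
by apply: (@xi_power b.1 b.2.+1 (block_word bs)); rewrite ldiv_block_word.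
Qed.

(** The vanishing condition of [G]-independence enters here: in block form the letters are
    admissible and every factor is centered. *)
Lemma tau_xi (w : word) : tau (xi w) = (w == [::])%:R.
Proof.
case: w => [|v w]; first exact: tau_unit CA.
have [bs eq_bs abs] := block_word_exists e_sym (v :: w).
rewrite (xi_trace eq_bs) xi_block //.
have bs0 : (0 < size bs)%N.
  by case: bs eq_bs {abs} => // /trace_equiv_perm/perm_size.
rewrite (big_nth (v, 0%N)) -(size_map fst bs) big_mkord.
rewrite [RHS](_ : _ = 0) //; have H := ind_s.2 _ _ _ (adm_G_admissible e_sym (x0 := v) abs)
  (fun j => let b := nth (v, 0%N) bs j in chebs b.1 b.2.+1).
apply: H.
  by rewrite size_map.
move=> j; rewrite (nth_map (v, 0%N)) -?(size_map fst) //.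
split; first exact: generated_horner.
exact: (tau_cheb CA (sc_s _)).
Qed.

(** Moving the self-adjoint [s v] from the left word to the right one gives three indicators:
    [w ~ v x], [w ~ x / v] and, with a minus sign, [w / v ~ x]. By left cancellation the first and
    third cancel and the second is [v w ~ x]. *)
Lemma xi_orthonormal (w x : word) :
  tau (star (xi w) * xi x) = `[< trace_equiv e w x >]%:R.
Proof.
have [n] := ubnP (size w); elim: n w x => // n IH [|v w] x wn.
  rewrite /xi /= (star1 CA) mul1r -/(xi x) tau_xi; congr ((nat_of_bool _)%:R).
  case: x => [|c x] /=; first by rewrite asboolT //; apply: rst_refl.
  by rewrite asboolF // => /trace_equiv_perm/perm_size.
rewrite /= ltnS in wn.
rewrite xi_cons (starB CA) (star_mul CA) (sc_s v).1 mulrBl (tauB CA) -mulrA mul_xi.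
rewrite mulrDr (tau_add CA) IH //.
have -> : tau (star (xi w) * (if ldiv e v x then xi (lrem v x) else 0)) =
    (ldiv e v x && `[< trace_equiv e w (lrem v x) >])%:R.
  by case: ifP => _; rewrite ?IH // mulr0 (tau0 CA).
have -> : tau (star (if ldiv e v w then xi (lrem v w) else 0) * xi x) =
    (ldiv e v w && `[< trace_equiv e (lrem v w) x >])%:R.
  case: ifP => _; last by rewrite (star0 CA) mul0r (tau0 CA).
  by rewrite IH // (leq_ltn_trans (lrem_size_le _ _)).
have -> : `[< trace_equiv e w (v :: x) >] =
    ldiv e v w && `[< trace_equiv e (lrem v w) x >].
  apply/asboolP/andP => [/(rst_sym _ _ _ _)/(trace_equiv_consP e_sym)|].
    by case=> dw eqr; split=> //; apply/asboolP/rst_sym.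
  case=> dw /asboolP eqr.
  by apply/rst_sym/(trace_equiv_consP e_sym); split=> //; apply: rst_sym.
rewrite addrAC subrr add0r; congr ((nat_of_bool _)%:R).
apply/andP/asboolP => [[dx /asboolP eqr]|/(trace_equiv_consP e_sym)[dx eqr]].
  by apply/(trace_equiv_consP e_sym).
by split=> //; apply/asboolP.
Qed.

End ChebyshevWords.

(** * Finite sums and finitely supported vectors in l2 *)

Lemma sum_mem_swap (V : nmodType) (T : eqType) (r1 r2 : seq T) (F : T -> V) :
  uniq r1 -> uniq r2 ->
  \sum_(x <- r1 | x \in r2) F x = \sum_(x <- r2 | x \in r1) F x.
Proof.
move=> u1 u2; rewrite -big_filter -[RHS]big_filter; apply: perm_big.
apply: uniq_perm; try exact: filter_uniq.
by move=> x; rewrite !mem_filter andbC.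
Qed.

Lemma sum_subseq (V : nmodType) (T : eqType) (r1 r2 : seq T) (F : T -> V) :
  uniq r1 -> uniq r2 -> {subset r1 <= r2} ->
  \sum_(x <- r1) F x = \sum_(x <- r2 | x \in r1) F x.
Proof.
by move=> u1 u2 sub; rewrite -sum_mem_swap // big_seq_cond [RHS]big_seq_cond;
   apply: eq_bigl => x; case: (boolP (x \in r1)) => //= /sub ->.
Qed.

Section FiniteL2.
Context (R : realType) (T : choiceType).

Definition restr (F : seq T) (f : T -> R[i]) (x : T) : R[i] :=
  if x \in F then f x else 0.

Lemma cmod0 : cmod (0 : R[i]) = 0.
Proof. exact: (@cmod_real R 0 (lexx _)). Qed.

Lemma cmodM (c d : R[i]) : cmod (c * d) = cmod c * cmod d.
Proof. exact: Normc.normcM. Qed.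

Lemma conj_mul_cmod (c : R[i]) : c^* * c = real_complex R (cmod c ^+ 2).
Proof.
case: c => a b; rewrite /cmod /= sqr_sqrtr ?addr_ge0 ?sqr_ge0 //.
apply/eqP; rewrite eq_complex /=; apply/andP; split; apply/eqP; ring.
Qed.

Lemma l2_sqnorm_le (f : T -> R[i]) (c : R) :
  (forall r, uniq r -> \sum_(x <- r) cmod (f x) ^+ 2 <= c) -> (l2_sqnorm f <= c%:E)%E.
Proof.
move=> H; apply: ge_ereal_sup => _ [X [finX _] <-].
have /finite_seqP[r ->] := finX.
rewrite (_ : [set` r] = [set` undup r]); last by apply/seteqP; split=> x /=; rewrite mem_undup.
by rewrite -fsbig_seq ?undup_uniq //= sumEFin lee_fin H // undup_uniq.
Qed.

Lemma le_l2_sqnorm (f : T -> R[i]) (r : seq T) : uniq r ->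
  ((\sum_(x <- r) cmod (f x) ^+ 2)%:E <= l2_sqnorm f)%E.
Proof.
move=> ur; apply: esum_ge; exists [set` r] => //.
by rewrite -fsbig_seq //= sumEFin.
Qed.

Lemma sqrte_le1 (x : \bar R) : (sqrte x <= 1)%E = (x <= 1)%E.
Proof.
have s1 : sqrte (1%E : \bar R) = 1%E by rewrite /sqrte /= sqrtr1.
by rewrite -[in LHS]s1 lee_sqrt // lee01.
Qed.

Lemma l2_sqnorm_ge0 (f : T -> R[i]) : (0 <= l2_sqnorm f)%E.
Proof. by apply: esum_ge0 => x _; rewrite lee_fin sqr_ge0. Qed.

Lemma sum_cmod_sub (f : T -> R[i]) (r1 r2 : seq T) :
  uniq r1 -> uniq r2 -> {subset r1 <= r2} ->
  \sum_(x <- r1) cmod (f x) ^+ 2 <= \sum_(x <- r2) cmod (f x) ^+ 2.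
Proof.
move=> u1 u2 sub; rewrite (sum_subseq _ u1 u2 sub) big_mkcond /=.
by apply: ler_sum => x _; case: ifP; rewrite ?sqr_ge0.
Qed.

Lemma l2_sqnorm_restr_le (F : seq T) (f : T -> R[i]) : uniq F ->
  (l2_sqnorm (restr F f) <= (\sum_(x <- F) cmod (f x) ^+ 2)%:E)%E.
Proof.
move=> uF; apply: l2_sqnorm_le => r ur.
rewrite (_ : \sum_(x <- r) _ = \sum_(x <- r | x \in F) cmod (f x) ^+ 2).
  rewrite sum_mem_swap // big_mkcond; apply: ler_sum => x _.
  by case: ifP; rewrite ?sqr_ge0.
rewrite [RHS]big_mkcond; apply: eq_bigr => x _; rewrite /restr.
by case: ifP => //; rewrite cmod0 expr0n.
Qed.

End FiniteL2.

(** * The Cayley graph of the trace monoid *)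

Section TraceMonoid.
Context (L : nat) (e : rel 'I_L).
Hypotheses (e_sym : symmetric e).

Notation word := (seq 'I_L).
Notation M := (trace_monoid e).

Definition tcls (w : word) : M :=
  exist (fun X => exists w, X = trace_class e w) (trace_class e w) (ex_intro _ w erefl).

Definition trep (x : M) : word := projT1 (cid (svalP (x : trace_monoid_carrier e))).

Lemma trepP (x : M) : sval (x : trace_monoid_carrier e) = trace_class e (trep x).
Proof. by rewrite /trep; case: cid. Qed.

Lemma trace_class_eq (w x : word) :
  trace_class e w = trace_class e x <-> trace_equiv e w x.
Proof.
split=> [E|E].
  have : trace_class e x x by apply: rst_refl.
  by rewrite -E.
apply/seteqP; split=> y /= H; last exact: rst_trans E H.
exact: rst_trans (rst_sym _ _ _ _ E) H.
Qed.

Lemma sval_inj_trace (x y : M) :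
  sval (x : trace_monoid_carrier e) = sval (y : trace_monoid_carrier e) -> x = y.
Proof.
move: x y => [X pX] [Y pY] /= E; move: pX pY; rewrite E => pX pY.
by rewrite (Prop_irrelevance pX pY).
Qed.

Lemma tcls_eq (w x : word) : tcls w = tcls x <-> trace_equiv e w x.
Proof.
rewrite -trace_class_eq; split=> [/(congr1 (fun z : trace_monoid_carrier e => sval z)) //|E].
exact: sval_inj_trace.
Qed.

Lemma trep_cls (w : word) : trace_equiv e w (trep (tcls w)).
Proof. by apply/trace_class_eq; rewrite -trepP. Qed.

Lemma tcls_rep (x : M) : tcls (trep x) = x.
Proof. by apply: sval_inj_trace; rewrite [RHS]trepP. Qed.

Lemma tcls_rep_eq (w : word) (x : M) : trace_equiv e w (trep x) -> tcls w = x.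
Proof. by move=> /tcls_eq ->; rewrite tcls_rep. Qed.

(** The two halves, of word length one more and one less, correspond to the two terms of
    [mul_xi]. *)
Definition nbrs (x : M) : seq M :=
  [seq tcls (v :: trep x) | v <- index_enum 'I_L] ++
  [seq tcls (lrem v (trep x)) | v <- [seq v <- index_enum 'I_L | ldiv e v (trep x)]].

Lemma cons_equiv_inj (u v : 'I_L) (w : word) :
  trace_equiv e (u :: w) (v :: w) -> u = v.
Proof.
move/trace_equiv_perm/permP/(_ (pred1 u)) => /= /eqP.
by rewrite eqn_add2r eqxx; case: (eqVneq v u).
Qed.

(** Between the halves word lengths differ by two; within a half, two coinciding neighbours give
    equivalent words with a common tail, and counting letters identifies their heads. *)
Lemma nbrs_uniq (x : M) : uniq (nbrs x).
Proof.
rewrite cat_uniq; apply/and3P; split.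
- rewrite map_inj_uniq ?index_enum_uniq // => u v /tcls_eq; exact: cons_equiv_inj.
- apply/hasPn => y /mapP[v]; rewrite mem_filter => /andP[dv _] ->.
  apply/negP => /mapP[u _] /tcls_eq /trace_equiv_perm/perm_size /=.
  by rewrite -(lrem_size dv) => /eqP; rewrite -addn2 -[X in X == _]addn0 eqn_add2l.
- rewrite map_inj_in_uniq ?filter_uniq ?index_enum_uniq // => u v.
  rewrite !mem_filter => /andP[du _] /andP[dv _] /tcls_eq E.
  apply: (@cons_equiv_inj u v (lrem u (trep x))).
  apply: rst_trans (rst_sym _ _ _ _ (ldiv_equiv du)) _.
  apply: rst_trans (ldiv_equiv dv) _; apply: trace_equiv_cons.
  exact: rst_sym.
Qed.

Lemma mem_nbrs (x y : M) : (y \in nbrs x) <-> cayley_adj x y.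
Proof.
rewrite mem_cat; split.
  case/orP=> /mapP[v].
    by move=> _ ->; exists v, (trep x); right; rewrite -trepP.
  rewrite mem_filter => /andP[dv _] ->; exists v, (lrem v (trep x)); left.
  by rewrite trepP; split=> //; apply/trace_class_eq/ldiv_equiv.
case=> v [w [] []].
  rewrite trepP => /trace_class_eq E yE; apply/orP; right.
  have [dv rv] := proj1 (trace_equiv_consP e_sym v w (trep x)) (rst_sym _ _ _ _ E).
  apply/mapP; exists v; first by rewrite mem_filter dv mem_index_enum.
  by apply: sval_inj_trace; rewrite yE; apply/trace_class_eq.
move=> yE; rewrite trepP => /trace_class_eq E; apply/orP; left.
apply/mapP; exists v; first by rewrite mem_index_enum.
apply: sval_inj_trace; rewrite yE; apply/trace_class_eq.
by apply: trace_equiv_cons; apply: rst_sym.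
Qed.

Lemma nbrs_sym (x y : M) : (y \in nbrs x) = (x \in nbrs y).
Proof.
by apply/idP/idP => /mem_nbrs [v [w H]]; apply/mem_nbrs; exists v, w; case: H; auto.
Qed.

Lemma adjacency_opE (R : realType) (f : M -> R[i]) (x : M) :
  adjacency_op f x = \sum_(y <- nbrs x) f y.
Proof.
rewrite /adjacency_op (_ : [set y | cayley_adj x y] = [set` nbrs x]).
  by rewrite -fsbig_seq // nbrs_uniq.
by apply/seteqP; split=> y /= /mem_nbrs.
Qed.

Lemma adjacency_op_restr (R : realType) (F : seq M) (f : M -> R[i]) (x : M) :
  {subset nbrs x <= F} -> adjacency_op (restr F f) x = adjacency_op f x.
Proof.
move=> sub; rewrite !adjacency_opE; apply: eq_big_seq => y /sub yF.
by rewrite /restr yF.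
Qed.

Lemma adjacency_opZ (R : realType) (c : R[i]) (f : M -> R[i]) (x : M) :
  adjacency_op (fun y => c * f y) x = c * adjacency_op f x.
Proof. by rewrite !adjacency_opE mulr_sumr. Qed.

(** Contains the support of [adjacency_op (restr F f)]. *)
Definition nbhd (F : seq M) : seq M := undup (F ++ flatten [seq nbrs x | x <- F]).

Lemma nbhd_uniq F : uniq (nbhd F). Proof. exact: undup_uniq. Qed.

Lemma sub_nbhd F : {subset F <= nbhd F}.
Proof. by move=> x xF; rewrite mem_undup mem_cat xF. Qed.

Lemma nbrs_nbhd F x : x \in F -> {subset nbrs x <= nbhd F}.
Proof.
move=> xF y yx; rewrite mem_undup mem_cat; apply/orP; right.
by apply/flattenP; exists (nbrs x) => //; apply: map_f.
Qed.

End TraceMonoid.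

(** * Multiplication by [S] as the adjacency operator, and the two inequalities *)

Section FockSpace.
Context (R : realType) (A : algType R[i]).
Variables (star : A -> A) (nrm : A -> R) (tau : A -> R[i]).
Hypothesis CA : Cstar_prob_space star nrm tau.
Context (L : nat) (e : rel 'I_L) (s : 'I_L -> A).
Hypotheses (e_sym : symmetric e) (e_irr : irreflexive e).
Hypothesis sc_s : forall i, semicircle_variable star tau (s i).
Hypothesis ind_s : G_independent_variables star tau e s.

Local Notation "r %:C" := (real_complex R r) : ring_scope.
Notation M := (trace_monoid e).
Notation S := (\sum_(i < L) s i).

Definition Xi (x : M) : A := xi e s (trep x).

Lemma Xi_cls (w : seq 'I_L) : Xi (tcls e w) = xi e s w.
Proof. by apply/esym/(xi_trace e_sym e_irr ind_s); exact: trep_cls. Qed.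

Lemma Xi_orthonormal (x y : M) : tau (star (Xi x) * Xi y) = (x == y)%:R.
Proof.
rewrite (xi_orthonormal CA) //; congr ((nat_of_bool _)%:R).
apply/asboolP/eqP => [E|->]; last exact: rst_refl.
by rewrite -(tcls_rep x); apply: tcls_rep_eq.
Qed.

Lemma sum_mul_Xi (x : M) : S * Xi x = \sum_(y <- nbrs x) Xi y.
Proof.
rewrite mulr_suml /nbrs big_cat big_map big_map big_filter /=.
under eq_bigr do rewrite mul_xi.
rewrite big_split /= -big_mkcond /=.
by congr (_ + _); apply: eq_bigr => v _; rewrite Xi_cls.
Qed.

(** For duplicate-free [F], an isometric copy in [A] of the truncation [restr F f], by [tau_Phi]. *)
Definition Phi (F : seq M) (f : M -> R[i]) : A := \sum_(x <- F) f x *: Xi x.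

Lemma tau_Phi (F : seq M) (f : M -> R[i]) : uniq F ->
  tau (star (Phi F f) * Phi F f) = (\sum_(x <- F) cmod (f x) ^+ 2)%:C.
Proof.
move=> uF; rewrite (star_sum CA) mulr_suml (tau_sum CA) rmorph_sum.
apply: eq_big_seq => x xF; rewrite mulr_sumr (tau_sum CA) (bigD1_seq x) //=.
rewrite big1 => [|y yx]; rewrite (star_scale CA) -scalerAl -scalerAr !(tau_scale CA)
  Xi_orthonormal.
  by rewrite eqxx addr0 mulr1 conj_mul_cmod.
by rewrite eq_sym (negPf yx) !mulr0.
Qed.

Lemma sum_mul_Phi (F : seq M) (f : M -> R[i]) : uniq F ->
  S * Phi F f = Phi (nbhd F) (adjacency_op (restr F f)).
Proof.
move=> uF; rewrite /Phi mulr_sumr.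
transitivity (\sum_(x <- F) \sum_(y <- nbhd F | y \in nbrs x) f x *: Xi y).
  apply: eq_big_seq => x xF; rewrite -scalerAr sum_mul_Xi -scaler_sumr.
  by rewrite (sum_subseq _ (nbrs_uniq x) (nbhd_uniq F) (nbrs_nbhd xF)).
rewrite (exchange_big_dep xpredT) //=; apply: eq_bigr => y _.
rewrite adjacency_opE // scaler_suml.
transitivity (\sum_(x <- F | x \in nbrs y) f x *: Xi y).
  by apply: eq_bigl => x; rewrite nbrs_sym.
rewrite sum_mem_swap ?nbrs_uniq // big_mkcond /=.
by apply: eq_bigr => x _; rewrite /restr; case: ifP => //; rewrite scale0r.
Qed.

Lemma Phi_restr (F H : seq M) (f : M -> R[i]) : uniq F -> uniq H ->
  {subset F <= H} -> Phi F f = Phi H (restr F f).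
Proof.
move=> uF uH sub; rewrite /Phi (sum_subseq _ uF uH sub) big_mkcond /=.
by apply: eq_bigr => x _; rewrite /restr; case: ifP => //; rewrite scale0r.
Qed.

Lemma PhiD (F : seq M) (f g : M -> R[i]) :
  Phi F f + Phi F g = Phi F (fun x => f x + g x).
Proof. by rewrite /Phi -big_split /=; apply: eq_bigr => x _; rewrite scalerDl. Qed.

Lemma horner_Phi (p : {poly R[i]}) :
  exists F f, uniq F /\ horner_alg S p = Phi F f.
Proof.
elim/poly_ind: p => [|p c [F [f [uF pE]]]].
  by exists [::], (fun=> 0); rewrite rmorph0 /Phi big_nil.
(* The constant [c] of the Horner step is [c *: Xi x0]; [H] is a common support for it and for the
   product with [S]. *)
pose x0 := tcls e [::]; pose H := undup (x0 :: nbhd F).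
have uH : uniq H := undup_uniq _.
have subx : {subset [:: x0] <= H}.
  by move=> x; rewrite mem_seq1 => /eqP ->; rewrite mem_undup mem_head.
have subF : {subset nbhd F <= H} by move=> x xF; rewrite mem_undup in_cons xF orbT.
pose g := restr (nbhd F) (adjacency_op (restr F f)).
exists H, (fun x => g x + restr [:: x0] (fun=> c) x); split=> //.
rewrite -PhiD -!Phi_restr ?nbhd_uniq // -sum_mul_Phi // -pE.
rewrite /Phi big_seq1 Xi_cls /xi /= rmorphD /= horner_algC; congr (_ + _).
by rewrite mulrC rmorphM /= horner_algX.
Qed.

Lemma sum_cmod_adjacency_le (F : seq M) (f : M -> R[i]) : uniq F ->
  \sum_(x <- nbhd F) cmod (adjacency_op (restr F f) x) ^+ 2 <=
  nrm S ^+ 2 * \sum_(x <- F) cmod (f x) ^+ 2.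
Proof.
move=> uF; have := sqnorm_mul_le CA S (Phi F f).
by rewrite sum_mul_Phi // !tau_Phi ?nbhd_uniq // -rmorphM lecR.
Qed.

Lemma adjacency_opnorm_le : (adjacency_opnorm R e <= (nrm S)%:E)%E.
Proof.
apply: ge_ereal_sup => _ [f [_ f1] <-].
have {}f1 : (l2_sqnorm f <= 1%:E)%E.
  by rewrite -sqrte_le1.
have -> : (nrm S)%:E = sqrte (nrm S ^+ 2)%:E.
  by rewrite /sqrte /= sqrtr_sqr ger0_norm // (nrm_ge0 CA).
rewrite lee_sqrt ?lee_fin ?sqr_ge0 //; apply: l2_sqnorm_le => r ur.
(* [F] contains all neighbours of [r], so truncating [f] to [F] leaves its image under the operator
   unchanged on [r]. *)
pose F := nbhd r.
have sub : {subset r <= nbhd F} by move=> x /(@sub_nbhd _ _ r) /(@sub_nbhd _ _ F).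
have E : \sum_(x <- r) cmod (adjacency_op f x) ^+ 2 =
         \sum_(x <- r) cmod (adjacency_op (restr F f) x) ^+ 2.
  apply: eq_big_seq => x xr; rewrite adjacency_op_restr //; exact: nbrs_nbhd.
rewrite E; apply: le_trans (sum_cmod_sub _ ur (nbhd_uniq F) sub) _.
apply: le_trans (sum_cmod_adjacency_le f (nbhd_uniq r)) _.
rewrite ler_piMr ?sqr_ge0 // -lee_fin; apply: le_trans f1.
exact: le_l2_sqnorm (nbhd_uniq r).
Qed.

Lemma nrm_le_adjacency_opnorm : ((nrm S)%:E <= adjacency_opnorm R e)%E.
Proof.
have sS : star S = S by rewrite (star_sum CA); apply: eq_bigr => i _; case: (sc_s i).
have bound (f : M -> R[i]) : in_l2 f -> (l2_norm f <= 1)%E ->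
    (l2_norm (adjacency_op f) <= adjacency_opnorm R e)%E.
  by move=> f1 f2; apply: ereal_sup_ubound; exists f.
(* Together with nonnegativity this makes the operator norm a real number [m]. *)
have := adjacency_opnorm_le.
have : (0 <= adjacency_opnorm R e)%E.
  have Z : (l2_sqnorm (fun _ : M => 0%R : R[i]) <= 0%:E)%E.
    by apply: l2_sqnorm_le => r _; rewrite big1 // => x _; rewrite cmod0 expr0n.
  apply: le_trans (bound (fun=> 0%R) _ _); first exact: sqrte_ge0.
    exact: le_lt_trans Z (ltry _).
  rewrite /l2_norm (_ : l2_sqnorm _ = 0%E) ?sqrte0 ?lee01 //.
  by apply/eqP; rewrite eq_le Z l2_sqnorm_ge0.
case: (adjacency_opnorm R e) bound => [m||] bound //; rewrite ?lee_fin => m0 _.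
apply: (nrm_le_of_sqnorm_mul CA m0 sS) => p; cbv zeta.
have [F [f [uF ->]]] := horner_Phi p.
rewrite sum_mul_Phi // !tau_Phi ?nbhd_uniq // -rmorphM lecR.
set N := \sum_(x <- F) _.
have N0 : 0 <= N by apply: sumr_ge0 => x _; rewrite sqr_ge0.
(* A zero vector cannot be normalized, but the bound by [nrm S] already makes its image zero. *)
have [Nz|Nz] := eqVneq N 0.
  have := sum_cmod_adjacency_le f uF; rewrite -/N Nz !mulr0; apply.
(* The operator norm is a supremum over the unit ball, so the vector is scaled to norm 1 and the
   bound scaled back. *)
pose c := (Num.sqrt N)^-1.
have c0 : 0 <= c by rewrite invr_ge0 sqrtr_ge0.
have cN : c ^+ 2 * N = 1 by rewrite exprVn sqr_sqrtr // mulVf.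
pose g (x : M) := c%:C * restr F f x.
have gE : g = restr F (fun x => c%:C * f x).
  by apply/funext => x; rewrite /g /restr; case: ifP => //; rewrite mulr0.
have g1 : (l2_sqnorm g <= 1%:E)%E.
  rewrite gE; apply: le_trans (l2_sqnorm_restr_le _ uF) _; rewrite lee_fin -cN mulr_sumr.
  by apply: ler_sum => x _; rewrite cmodM cmod_real // exprMn.
have := bound g (le_lt_trans g1 (ltry _)).
rewrite /l2_norm => H; have {}H : (sqrte (l2_sqnorm (adjacency_op g)) <= m%:E)%E.
  by apply: H; rewrite sqrte_le1.
have {}H : (l2_sqnorm (adjacency_op g) <= (m ^+ 2)%:E)%E.
  rewrite -lee_sqrt ?lee_fin ?sqr_ge0 //; apply: le_trans H _.
  by rewrite /= sqrtr_sqr ger0_norm.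
have := le_trans (le_l2_sqnorm (adjacency_op g) (nbhd_uniq F)) H; rewrite lee_fin.
rewrite (eq_bigr (fun x => c ^+ 2 * cmod (adjacency_op (restr F f) x) ^+ 2)); last first.
  by move=> x _; rewrite adjacency_opZ // cmodM cmod_real // exprMn.
rewrite -mulr_sumr => H'.
have Np : 0 < N by rewrite lt_def Nz.
by rewrite -[X in X <= _]mul1r -cN mulrAC ler_pM2r.
Qed.

End FockSpace.

Theorem theorem1p4 (R : realType) (L : nat) (e : rel 'I_L)
    (A : algType R[i]) (star : A -> A) (nrm : A -> R) (tau : A -> R[i])
    (s : 'I_L -> A) :
  simple_loopless_graph e ->
  Cstar_prob_space star nrm tau ->
  (forall i, semicircle_variable star tau (s i)) ->
  G_independent_variables star tau e s ->
  ((nrm (\sum_(i < L) s i))%:E = adjacency_opnorm R e)%E.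
Proof.
move=> [e_sym e_irr'] CA sc_s ind_s.
have e_irr : irreflexive e by move=> i; apply/negbTE.
apply/eqP; rewrite eq_le.
by rewrite (nrm_le_adjacency_opnorm CA) // (adjacency_opnorm_le CA).
Qed.
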